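(* Let $(X^0,U^0)\in\mathbb C(\mathcal{COP}(p))$ with $T_a(X^0)\neq\emptyset$, and suppose that Assumptions j), jj), jjj) hold for $(X^0,U^0)$. Then there exists $\varepsilon_0>0$ such that a pair $(X,U)\in\mathbb S(p)\times\mathbb S(p)$ with $\|(X,U)-(X^0,U^0)\|\le\varepsilon_0$ belongs to $\mathbb C(\mathcal{COP}(p))$ if and only if there exist matrices $W(s)\in\mathbb S(p(s))$, $s\in S$, such that $$\mathcal A(X,s)W(s)+W(s)\mathcal A(X,s)=\mathbb O_{p(s)\times p(s)}\quad\forall s\in S,\qquad U=\sum_{s\in S}\mathcal B(W(s),s).$$
   Context: Let $p$ be a positive integer, $P=\{1,\dots,p\}$, $e_1,\dots,e_p$ the standard basis of $\mathbb R^p$, and $\mathbb R^p_+$ the nonnegative orthant. $\mathbb S(p)$ is the space of real symmetric $p\times p$ matrices with inner product $X\bullet U=\mathrm{trace}(XU)$ and any fixed norm $\|\cdot\|$ (also on products). $\mathbb O_{n\times q}$ is the $n\times q$ zero matrix. $\|t\|_1=\sum_k|t_k|$, $\mathrm{supp}(t)=\{k\in P:t_k\ne0\}$, $T=\{t\in\mathbb R^p_+:\|t\|_1=1\}$. $\mathcal{COP}(p)=\{D\in\mathbb S(p):t^\top Dt\ge0\ \forall t\in\mathbb R^p_+\}$ is the copositive cone and $\mathcal{CP}(p)=\mathrm{cone}\{tt^\top:t\in\mathbb R^p_+\}$ is its dual, the cone of completely positive matrices (cone = conic hull). The complementarity set is $\mathbb C(\mathcal{COP}(p))=\{(X,U):X\in\mathcal{COP}(p),\,U\in\mathcal{CP}(p),\,X\bullet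 U=0\}$. Data attached to $X^0\in\mathcal{COP}(p)$. $T_a(X^0)=\{t\in T:t^\top X^0t=0\}$ (empty or a finite union of bounded convex polyhedra), assumed nonempty. $\tau(j)$, $j\in J\subset\mathbb N$, are all the vertices of $\mathrm{conv}\,T_a(X^0)$, and $M(j)=\{k\in P:e_k^\top X^0\tau(j)=0\}$. The (finite) set $J$ is divided into the maximum number of (possibly overlapping) subsets $J(s)$, $s\in S\subset\mathbb N$, $|S|\ge1$, such that: a) $J=\bigcup_{s\in S}J(s)$; b) for every $s\in S$, $\bigcup_{j\in J(s)}\mathrm{supp}(\tau(j))\subset M(i)$ for all $i\in J(s)$; c) if $|S|\ge2$, then for all $s,\bar s\in S$ with $s\ne\bar s$: $J(s)\setminus J(\bar s)\ne\emptyset$, $J(\bar s)\setminus J(s)\neq\emptyset$, and for every $i_0\in J(s)\setminus J(\bar s)$ there exist $j_0\in J(\bar s)\setminus J(s)$ and $k_0\in\mathrm{supp}(\tau(i_0))$ with $k_0\notin M(j_0)$. It is known that then $T_a(X^0)=\bigcup_{s\in S}T_a(s,X^0)$, where $T_a(s,X^0)=\mathrm{conv}\{\tau(j):j\in J(s)\}$. Put $P_*(s)=\bigcup_{j\in J(s)}\mathrm{supp}(\tau(j))$ and $p(s)=|P_*(s)|$. For a set $I\subset\mathbb N$, $V(I)=\{(i,j):i,j\in I,\ i\le j\}$. For $s\in S$, $J_b(s)\subset J(s)$ is such that $\{\tau(j):j\in J_b(s)\}$ is a basis of $\mathrm{span}\{\tau(j):j\in J(s)\}$. For $X\in\mathbb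 S(p)$, $\mathcal A(X,s)\in\mathbb S(p(s))$ is the principal submatrix of $X$ with rows and columns indexed by $P_*(s)$. For $W\in\mathbb S(p(s))$ (entries indexed by $P_*(s)\times P_*(s)$), $\mathcal B(W,s)\in\mathbb S(p)$ is the matrix whose $(k,q)$ entry is $w_{kq}$ if $k,q\in P_*(s)$ and $0$ otherwise. Assumptions on a pair $(X^0,U^0)\in\mathbb C(\mathcal{COP}(p))$: j) $U^0$ is strictly complementary to $X^0$, i.e. $U^0\in\mathrm{ri}\big(\mathcal{CP}(p)\cap (X^0)^\perp\big)$, where ri is relative interior and $(X^0)^\perp=\{U\in\mathbb S(p):X^0\bullet U=0\}$; jj) the family of matrices $(\tau(i)+\tau(j))(\tau(i)+\tau(j))^\top$, $(i,j)\in V(J_b(s))$, $s\in S$ (indexed by all $s$ and $(i,j)$), is linearly independent; jjj) $M(j)=P_*(s)$ for all $j\in J(s)$ and all $s\in S$. *)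

(* Defs.v *)
From HB Require Import structures.
From mathcomp Require Import all_boot all_order all_algebra.
From mathcomp Require Import all_classical all_reals all_analysis.
Import Order.TTheory GRing.Theory Num.Theory.
Import numFieldNormedType.Exports.

Set Implicit Arguments.
Unset Strict Implicit.
Unset Printing Implicit Defensive.

Local Open Scope ring_scope.

Section Hulls.
Context {R : realType} {V : lmodType R}.
Implicit Types (A : set V) (x : V).

Definition convex_hull A : set V := [set x |
  exists (n : nat) (c : 'I_n -> R) (a : 'I_n -> V),
    [/\ forall i, 0 <= c i, \sum_i c i = 1,
        forall i, A (a i) & x = \sum_i c i *: a i] ]%classic.

Definition conic_hull A : set V := [set x |
  exists (n : nat) (c : 'I_n -> R) (a : 'I_n -> V),
    [/\ forall i, 0 <= c i, forall i, A (a i) &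
        x = \sum_i c i *: a i] ]%classic.

Definition affine_hull A : set V := [set x |
  exists (n : nat) (c : 'I_n -> R) (a : 'I_n -> V),
    [/\ \sum_i c i = 1, forall i, A (a i) & x = \sum_i c i *: a i] ]%classic.

(* The vertices of a polytope are its extreme points. *)
Definition vertices A : set V := [set x |
  A x /\ forall (y z : V) (a : R), A y -> A z -> 0 < a < 1 ->
           x = a *: y + (1 - a) *: z -> y = x /\ z = x]%classic.

(* [N] restricts to a norm on the subspace [A]; its values outside [A] are
   irrelevant. *)
Definition norm_on A (N : V -> R) : Prop :=
  [/\ forall x, A x -> 0 <= N x,
      forall x, A x -> N x = 0 -> x = 0,
      forall (a : R) x, A x -> N (a *: x) = `|a| * N x &
      forall x y, A x -> A y -> N (x + y) <= N x + N y].

End Hulls.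

Section Matrices.
Context {R : realType} {p : nat}.
Implicit Types (X U : 'M[R]_p) (t u : 'cV[R]_p).

Lemma symmetricmxP X : reflect (X^T = X) (X \is symmetricmx).
Proof.
rewrite qualifE /= expr0 scale1r map_mx_id //.
by rewrite eq_sym; exact: eqP.
Qed.

(* Interior relative to the affine hull, for the usual topology on matrices. *)
Definition relative_interior (C : set 'M[R]_p) : set 'M[R]_p := [set x |
  C x /\ \forall y \near x, affine_hull C y -> C y]%classic.

Definition bil X t u : R := (t^T *m X *m u) 0 0.

Definition ebase (k : 'I_p) : 'cV[R]_p := delta_mx k 0.

Definition inner X U : R := \tr (X *m U).

Definition nonneg t : Prop := forall k, 0 <= t k 0.

Definition supp t : {set 'I_p} := [set k | t k 0 != 0].

Definition simplex : set 'cV[R]_p :=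
  [set t | nonneg t /\ \sum_k `|t k 0| = 1]%classic.

Definition COP : set 'M[R]_p :=
  [set D | D \is symmetricmx /\ forall t, nonneg t -> 0 <= bil D t t]%classic.

Definition CP : set 'M[R]_p :=
  conic_hull [set t *m t^T | t in nonneg]%classic.

Definition complementarity_set : set ('M[R]_p * 'M[R]_p) :=
  [set Z | [/\ COP Z.1, CP Z.2 & inner Z.1 Z.2 = 0] ]%classic.

Definition orthogonal_space X : set 'M[R]_p :=
  [set U | U \is symmetricmx /\ inner X U = 0]%classic.

Definition symmetric_pairs : set ('M[R]_p * 'M[R]_p) :=
  [set Z | Z.1 \is symmetricmx /\ Z.2 \is symmetricmx]%classic.

Definition zeros X : set 'cV[R]_p :=
  [set t | simplex t /\ bil X t t = 0]%classic.

End Matrices.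

(* The finite index sets J and S of the mathematics are numbered as 'I_m and
   'I_q, so that |J| = m, |S| = q, and "i <= j" on J is the order of 'I_m. *)

Section ZeroStructure.
Context {R : realType} {p m : nat}.
Variables (X : 'M[R]_p) (tau : 'I_m -> 'cV[R]_p).

Definition enumerates_vertices : Prop :=
  injective tau /\ range tau = vertices (convex_hull (zeros X)).

Definition M_set (j : 'I_m) : {set 'I_p} :=
  [set k | bil X (ebase k) (tau j) == 0].

Definition P_star (I : {set 'I_m}) : {set 'I_p} :=
  (\bigcup_(j in I) supp (tau j))%SET.

Definition admissible_division {q : nat} (Js : 'I_q -> {set 'I_m}) : Prop :=
  [/\ (\bigcup_s Js s)%SET = [set: 'I_m],
      forall s i, i \in Js s -> P_star (Js s) \subset M_set i &
      forall s s', s != s' ->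
        [/\ Js s :\: Js s' != finset.set0, Js s' :\: Js s != finset.set0 &
            forall i0, i0 \in Js s :\: Js s' ->
              exists j0 k0, [/\ j0 \in Js s' :\: Js s,
                                k0 \in supp (tau i0) & k0 \notin M_set j0] ] ].

Definition maximal_division {q : nat} (Js : 'I_q -> {set 'I_m}) : Prop :=
  [/\ (0 < q)%N, admissible_division Js &
      forall (q' : nat) (Js' : 'I_q' -> {set 'I_m}),
        admissible_division Js' -> (q' <= q)%N].

Definition V_pairs (I : {set 'I_m}) : {set 'I_m * 'I_m} :=
  [set ij | [&& ij.1 \in I, ij.2 \in I & (ij.1 <= ij.2)%N] ].

Definition basis_subset (Jb J : {set 'I_m}) : Prop :=
  Jb \subset J /\
  basis_of <<[seq tau j | j in J]>>%VS [seq tau j | j in Jb].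

(* The family (tau i + tau j) (tau i + tau j)^T over all s and (i, j) in
   V(Jb s); a pair occurring for several s is listed once for each. *)
Definition sum_squares {q : nat} (Jb : 'I_q -> {set 'I_m}) : seq 'M[R]_p :=
  [seq (tau ij.1 + tau ij.2) *m (tau ij.1 + tau ij.2)^T
     | s <- enum 'I_q, ij <- enum (V_pairs (Jb s))].

End ZeroStructure.

(* A matrix with entries indexed by P x P is encoded as an element of
   'M_#|P|, its rows and columns being numbered along the increasing
   enumeration of P: the entry at (k, l) is the one at the ranks of k and l. *)

Section Submatrices.
Context {R : realType} {p : nat}.
Variable (P : {set 'I_p}).

Definition principal_submx (X : 'M[R]_p) : 'M[R]_#|P| :=
  mxsub (@enum_val _ (mem P)) (@enum_val _ (mem P)) X.

Definition embed_mx (W : 'M[R]_#|P|) : 'M[R]_p :=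
  \matrix_(k, l)
    match @idP (k \in P), @idP (l \in P) with
    | ReflectT hk, ReflectT hl => W (enum_rank_in hk k) (enum_rank_in hl l)
    | _, _ => 0
    end.

Lemma embed_mx_in W (i j : 'I_#|P|) :
  embed_mx W (enum_val i) (enum_val j) = W i j.
Proof.
rewrite mxE; case: {-}_ / idP => [hi|/(_ (enum_valP i))//].
case: {-}_ / idP => [hj|/(_ (enum_valP j))//].
by rewrite !enum_valK_in.
Qed.

Lemma embed_mx_out W (k l : 'I_p) :
  ~~ ((k \in P) && (l \in P)) -> embed_mx W k l = 0.
Proof.
rewrite mxE; case: {-}_ / idP => // hk; case: {-}_ / idP => // hl.
by rewrite hk hl.
Qed.

End Submatrices.

(* Main.v *)
Require Import Defs.
From HB Require Import structures.
From mathcomp Require Import all_boot all_order all_algebra.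
From mathcomp Require Import all_classical all_reals all_analysis.
From mathcomp Require Import ring lra.
Import Order.TTheory GRing.Theory Num.Theory.
Import numFieldNormedType.Exports.

Set Implicit Arguments.
Unset Strict Implicit.
Unset Printing Implicit Defensive.

Local Open Scope ring_scope.

(** Every zero of [X0] in the simplex is a conic combination of vertices forming
    a clique for [tau(i)^T X0 tau(j) = 0], and the [Js s] are the maximal cliques.
    On the coordinates of [P_star tau (Js s)] the principal submatrix [A0] of [X0]
    is positive semidefinite with kernel the span of the [tau j], [j] in [Js s];
    by strict complementarity [U0] is the sum of the blocks of matrices [W0 s]
    lying in the relative interior of the corresponding faces, and by jj) the
    homogeneous linear system [A0 W + W A0 = 0] for all [s], [sum of blocks = 0]
    has only the trivial solution, so solutions near [X0], [U0] stay near [W0].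

    If [A W + W A = 0] near [(A0, W0)] then [A + W] is positive definite, which
    forces [A >= 0] and [A W = 0].  The Schur complement splitting of [A] along
    [ker A0] gives [G] near the identity on [ker A0] with [W = G W G^T], and
    membership of [W0] in the relative interior of its face makes [W] completely
    positive.  Conversely, if [A] is copositive and [A . W = 0], the Schur
    complement is copositive on a neighbourhood of the face and vanishes against
    a relative interior point, so [A >= 0] and hence [A W = 0].  Copositivity of
    the whole of [X], and the grouping of the rank one summands of [U] according
    to [s], follow from compactness of the simplex. *)

(** * The entrywise norm and bilinear forms *)

(** Under perturbation [ker A] may shrink and tilt against [ker A0], so a nearby [W] with [A W = 0]
    is only a tilted copy, by [G], of a matrix of the reference face. Tilting can turn a zero entry
    of a generator negative. The generators are therefore first pushed into the open orthant by a
    matrix close to the identity; the relative interior provides the room.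

    The two directions need different closeness arguments. The Lyapunov equations are linear in the
    blocks, so an estimate expressing injectivity applies at once. A pair in the complementarity set
    only provides vanishing traces: there the blocks are bounded by [U] because they are
    nonnegative, and positivity of [A0] turns a small trace into a small product.

    The division becomes a statement on cliques because b) says that each [Js s] is a clique, c)
    that it cannot be enlarged, and the maximal number that no maximal clique is missing.

    Estimates hold for all small [e > 0], the other variables being quantified inside, so that
    finitely many of them can be imposed on one [e]. *)

Section L1Norm.
Context {R : realType}.

Definition l1norm m n (A : 'M[R]_(m, n)) : R := \sum_i \sum_j `|A i j|.

Lemma l1norm_ge0 m n (A : 'M[R]_(m, n)) : 0 <= l1norm A.
Proof. by apply: sumr_ge0 => i _; apply: sumr_ge0. Qed.

Lemma le_l1norm m n (A : 'M[R]_(m, n)) i j : `|A i j| <= l1norm A.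
Proof.
rewrite /l1norm (bigD1 i) //= (bigD1 j) //= -addrA lerDl addr_ge0 //.
  exact: sumr_ge0.
by apply: sumr_ge0 => k _; apply: sumr_ge0.
Qed.

Lemma l1norm_eq0 m n (A : 'M[R]_(m, n)) : l1norm A = 0 -> A = 0.
Proof.
move=> A0; apply/matrixP => i j; rewrite mxE; apply/eqP.
by rewrite -normr_le0 -A0 le_l1norm.
Qed.

Lemma l1norm0 m n : l1norm (0 : 'M[R]_(m, n)) = 0.
Proof. by rewrite /l1norm big1 // => i _; rewrite big1 // => j _; rewrite mxE normr0. Qed.

Lemma l1normD m n (A B : 'M[R]_(m, n)) : l1norm (A + B) <= l1norm A + l1norm B.
Proof.
rewrite /l1norm -big_split; apply: ler_sum => i _.
by rewrite -big_split; apply: ler_sum => j _; rewrite mxE ler_normD.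
Qed.

Lemma l1normZ m n a (A : 'M[R]_(m, n)) : l1norm (a *: A) = `|a| * l1norm A.
Proof.
rewrite /l1norm mulr_sumr; apply: eq_bigr => i _.
by rewrite mulr_sumr; apply: eq_bigr => j _; rewrite mxE normrM.
Qed.

Lemma l1normN m n (A : 'M[R]_(m, n)) : l1norm (- A) = l1norm A.
Proof. by rewrite -scaleN1r l1normZ normrN1 mul1r. Qed.

Lemma l1norm_tr m n (A : 'M[R]_(m, n)) : l1norm A^T = l1norm A.
Proof.
rewrite /l1norm exchange_big; apply: eq_bigr => i _.
by apply: eq_bigr => j _; rewrite mxE.
Qed.

Lemma l1normM m n k (A : 'M[R]_(m, n)) (B : 'M[R]_(n, k)) :
  l1norm (A *m B) <= l1norm A * l1norm B.
Proof.
rewrite /l1norm mulr_suml; apply: ler_sum => i _.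
apply: (@le_trans _ _ (\sum_j \sum_l `|A i l| * `|B l j|)).
  apply: ler_sum => j _; rewrite mxE; apply: le_trans (ler_norm_sum _ _ _) _.
  by apply: ler_sum => l _; rewrite normrM.
rewrite exchange_big /= mulr_suml; apply: ler_sum => l _.
rewrite -mulr_sumr ler_wpM2l // (bigD1 l) //= lerDl.
by apply: sumr_ge0 => ? _; apply: sumr_ge0.
Qed.

Lemma near_l1norm m n (x : 'M[R]_(m, n)) (P : 'M[R]_(m, n) -> Prop) :
  (\forall y \near x, P y) ->
  \forall e \near at_right (0 : R), forall y, l1norm (y - x) <= e -> P y.
Proof.
move=> /nbhs_ballP [d /= d0 dP]; near=> e => y ye.
apply: dP; split=> // i j; rewrite /ball /= distrC.
have -> : y i j - x i j = (y - x) i j by rewrite !mxE.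
apply: le_lt_trans (le_l1norm _ _ _) _; apply: le_lt_trans ye _.
by near: e; exact: nbhs_right_lt.
Unshelve. all: by end_near. Qed.

Lemma mxtrace_le_l1norm n (A B : 'M[R]_n) : \tr (A *m B) <= l1norm A * l1norm B.
Proof.
apply: le_trans (l1normM A B); rewrite /mxtrace /l1norm; apply: ler_sum => i _.
by apply: le_trans (ler_norm _) _; rewrite (bigD1 i) //= lerDl sumr_ge0.
Qed.

Lemma near_mul_le (c d : R) : 0 < d -> \forall e \near at_right (0 : R), c * e <= d.
Proof.
move=> d0; near=> e; have c1 : 0 < `|c| + 1 by rewrite ltr_wpDl.
have : e <= d / (`|c| + 1) by near: e; apply: nbhs_right_le; rewrite divr_gt0.
have e0 : 0 <= e by [].
rewrite ler_pdivlMr // mulrDr mulr1 mulrC; apply: le_trans.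
apply: (@le_trans _ _ (`|c| * e)); first by rewrite ler_wpM2r // ler_norm.
by rewrite lerDl.
Unshelve. all: by end_near. Qed.

End L1Norm.

(** First-order condition at the end of a half-line: for small [s] the linear term outweighs the
    quadratic one. If [b < 0], the point [s = - b / (|c| + 1)] already makes the expression
    negative. *)
Lemma quadratic_ge0_linear_ge0 {R : realType} (b c : R) :
  (forall s, 0 <= s -> 0 <= s * b *+ 2 + s ^+ 2 * c) -> 0 <= b.
Proof.
move=> H; rewrite leNgt; apply/negP => b0.
have c1 : 0 < `|c| + 1 by have := normr_ge0 c; lra.
have s0 : 0 <= - (b / (`|c| + 1)) by rewrite -mulNr divr_ge0 ?oppr_ge0 ?ltW.
have := H _ s0.
have -> : - (b / (`|c| + 1)) * b *+ 2 + (- (b / (`|c| + 1))) ^+ 2 * c =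
  b ^+ 2 / (`|c| + 1) ^+ 2 * (c - (`|c| + 1) *+ 2).
  by field; rewrite gt_eqF.
have cc : c - (`|c| + 1) *+ 2 < 0 by have := ler_norm c; have := normr_ge0 c; lra.
rewrite nmulr_lge0 // => h; move: h; rewrite pmulr_lle0 ?invr_gt0 ?exprn_gt0 //.
by rewrite exprn_even_le0 //= lt_eqF.
Qed.

Section BilinearForms.
Context {R : realType} {n : nat}.
Implicit Types (A B X : 'M[R]_n) (x y z t u : 'cV[R]_n).

Lemma bilDl X x y z : bil X (x + y) z = bil X x z + bil X y z.
Proof. by rewrite /bil raddfD /= !mulmxDl mxE. Qed.

Lemma bilDr X x y z : bil X x (y + z) = bil X x y + bil X x z.
Proof. by rewrite /bil mulmxDr mxE. Qed.

Lemma bilZl X a x y : bil X (a *: x) y = a * bil X x y.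
Proof. by rewrite /bil linearZ /= -!scalemxAl mxE. Qed.

Lemma bilZr X a x y : bil X x (a *: y) = a * bil X x y.
Proof. by rewrite /bil -scalemxAr mxE. Qed.

Lemma bil_suml (I : Type) (r : seq I) X (F : I -> 'cV[R]_n) y :
  bil X (\sum_(i <- r) F i) y = \sum_(i <- r) bil X (F i) y.
Proof.
elim/big_rec2: _ => [|i a b _ <-]; last by rewrite bilDl.
by rewrite /bil trmx0 !mul0mx mxE.
Qed.

Lemma bil_sumr (I : Type) (r : seq I) X (F : I -> 'cV[R]_n) y :
  bil X y (\sum_(i <- r) F i) = \sum_(i <- r) bil X y (F i).
Proof.
elim/big_rec2: _ => [|i a b _ <-]; last by rewrite bilDr.
by rewrite /bil mulmx0 mxE.
Qed.

Lemma bilC X x y : X^T = X -> bil X x y = bil X y x.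
Proof.
move=> Xs; rewrite /bil -[in LHS](trmxK (_ *m _)) mxE.
by rewrite !trmx_mul trmxK Xs mulmxA.
Qed.

Lemma bilDm A B x y : bil (A + B) x y = bil A x y + bil B x y.
Proof. by rewrite /bil mulmxDr mulmxDl mxE. Qed.

Lemma bilNm A x y : bil (- A) x y = - bil A x y.
Proof. by rewrite /bil mulmxN mulNmx mxE. Qed.

Lemma bil_scale A a x y : bil (a *: A) x y = a * bil A x y.
Proof. by rewrite /bil -scalemxAr -scalemxAl mxE. Qed.

Lemma bil_mulmxr A B x y : bil A x (B *m y) = bil (A *m B) x y.
Proof. by rewrite /bil !mulmxA. Qed.

Lemma bil_sum_coord X t u :
  bil X t u = \sum_k t k 0 * (X *m u) k 0.
Proof. by rewrite /bil -mulmxA mxE; apply: eq_bigr => k _; rewrite mxE. Qed.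

Lemma bil_ebase X k u : bil X (ebase k) u = (X *m u) k 0.
Proof.
rewrite bil_sum_coord (bigD1 k) //= big1 ?addr0 => [|i /negPf ik].
  by rewrite [ebase k k 0]mxE !eqxx mul1r.
by rewrite [ebase k i 0]mxE ik mul0r.
Qed.

Lemma bil_ker X t u : X *m u = 0 -> bil X t u = 0.
Proof. by move=> Xu; rewrite /bil -mulmxA Xu mulmx0 mxE. Qed.

Lemma bil0l X u : bil X 0 u = 0.
Proof. by rewrite /bil trmx0 !mul0mx mxE. Qed.

Lemma norm_bil A x : `|bil A x x| <= l1norm A * bil 1%:M x x.
Proof.
have xx (i j : 'I_n) : `|x i 0| * `|x j 0| <= bil 1%:M x x.
  rewrite bil_sum_coord mul1mx.
  have sq (k : 'I_n) : `|x k 0| * `|x k 0| <= \sum_k x k 0 * x k 0.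
    rewrite -normrM ger0_norm -?expr2 ?sqr_ge0 // (bigD1 k) //= lerDl.
    by apply: sumr_ge0 => l _; rewrite -expr2 sqr_ge0.
  have [ij|ij] := leP `|x i 0| `|x j 0|.
    by apply: le_trans (sq j); apply: ler_wpM2r.
  by apply: le_trans (sq i); apply: ler_wpM2l => //; apply: ltW.
rewrite /bil -mulmxA mxE; apply: le_trans (ler_norm_sum _ _ _) _.
rewrite /l1norm mulr_suml; apply: ler_sum => i _; rewrite mxE normrM mxE.
rewrite (le_trans (ler_wpM2l _ (ler_norm_sum _ _ _))) //.
rewrite mulr_sumr mulr_suml; apply: ler_sum => j _.
by rewrite normrM mulrCA ler_wpM2l // xx.
Qed.

Definition psd A : Prop := forall x, 0 <= bil A x x.

Lemma bil1_ge0 x : 0 <= bil 1%:M x x.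
Proof.
rewrite bil_sum_coord mul1mx; apply: sumr_ge0 => k _.
by rewrite -expr2 sqr_ge0.
Qed.

Lemma bil1_eq0 x : bil 1%:M x x = 0 -> x = 0.
Proof.
rewrite bil_sum_coord mul1mx => /eqP; rewrite psumr_eq0 => [/allP x0|k _].
  apply/colP => k; rewrite mxE; apply/eqP.
  by have := x0 k (mem_index_enum _); rewrite -expr2 sqrf_eq0.
by rewrite -expr2 sqr_ge0.
Qed.

Lemma quadratic_ge0_linear0 (b c : R) :
  (forall s, 0 <= s * b *+ 2 + s ^+ 2 * c) -> b = 0.
Proof.
move=> H; apply/eqP; rewrite eq_le; apply/andP; split; last first.
  by apply: (@quadratic_ge0_linear_ge0 _ _ c) => s _; exact: H.
rewrite -oppr_ge0; apply: (@quadratic_ge0_linear_ge0 _ _ c) => s _.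
by have := H (- s); rewrite sqrrN mulNr mulrN.
Qed.

(** A zero of a positive semidefinite form is a minimum, so the derivative [2 A x] vanishes in each
    coordinate direction. *)
Lemma psd_ker A x : A^T = A -> psd A -> bil A x x = 0 -> A *m x = 0.
Proof.
move=> As Ap Ax; apply/colP => k; rewrite -bil_ebase !mxE.
apply: (@quadratic_ge0_linear0 _ (bil A (ebase k) (ebase k))) => s.
have := Ap (x + s *: ebase k).
rewrite !bilDl !bilDr !bilZl !bilZr Ax (bilC x _ As); congr (0 <= _).
by ring.
Qed.

Lemma mxtrace_gram m A (B : 'M[R]_(n, m)) :
  \tr (A *m (B *m B^T)) = \sum_j bil A (col j B) (col j B).
Proof.
rewrite mulmxA mxtrace_mulC mulmxA /mxtrace; apply: eq_bigr => j _.
rewrite /bil tr_col -row_mul !mxE; apply: eq_bigr => k _.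
by rewrite [row _ _ _ _]mxE [col _ _ _ _]mxE.
Qed.

Lemma mulmx_eq0_cols m k (A : 'M[R]_(k, n)) (B : 'M[R]_(n, m)) :
  (forall j, A *m col j B = 0) -> A *m B = 0.
Proof.
move=> AB; apply/matrixP => i j; rewrite [RHS]mxE.
have := congr1 (fun C : 'cV_k => C i 0) (AB j).
by rewrite /= [RHS]mxE => <-; rewrite !mxE; apply: eq_bigr => l _; rewrite mxE.
Qed.

End BilinearForms.

(** * Compactness, norms and positive forms *)

Section Compactness.
Context {R : realType}.

Lemma sum_continuous (T : topologicalType) (I : Type) (r : seq I) (F : I -> T -> R) :
  (forall i, continuous (F i)) -> continuous (fun x => \sum_(i <- r) F i x).
Proof. by move=> Fc; apply: continuous_big => //; exact: add_continuous. Qed.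

Lemma mul_continuous (T : topologicalType) (f g : T -> R) :
  continuous f -> continuous g -> continuous (fun x => f x * g x).
Proof. by move=> fc gc x; apply: cvgM; [exact: fc|exact: gc]. Qed.

Lemma near_gt (T : topologicalType) (f : T -> R) (x : T) c :
  continuous f -> c < f x -> \forall y \near x, c < f y.
Proof. by move=> fc cx; apply: (@cvgr_gt _ _ (nbhs x) _ f (f x)) => //; exact: fc. Qed.

Lemma l1norm_continuous m n : continuous (@l1norm R m n).
Proof.
apply: sum_continuous => i; apply: sum_continuous => j A.
exact: cvg_norm (@coord_continuous _ _ _ i j A).
Qed.

Lemma l1norm_near m n (x : 'M[R]_(m, n)) e : 0 < e ->
  \forall y \near x, l1norm (y - x) <= e.
Proof.
move=> e0; apply/nbhs_ballP; pose d := e / (m * n).+1%:R.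
have d0 : 0 < d by rewrite divr_gt0 ?ltr0n.
exists d => //= y [_ xy]; apply: (@le_trans _ _ (d *+ (m * n))).
  rewrite /l1norm mulnC mulrnA -[in leRHS](card_ord m) -sumr_const.
  apply: ler_sum => i _; rewrite -[in leRHS](card_ord n) -sumr_const.
  apply: ler_sum => j _; have := xy i j; rewrite /ball /= => /ltW.
  by rewrite !mxE distrC.
rewrite -mulr_natr mulrAC ler_pdivrMr ?ltr0n // ler_pM2l // ler_nat.
exact: leqnSn.
Qed.

Lemma compact_box_closed n (A : set 'rV[R]_n) : closed A ->
  (forall x, A x -> forall i, `|x 0 i| <= 1) -> compact A.
Proof.
move=> Acl Ab.
have Bc : compact [set x : 'rV[R]_n | forall i, x ord0 i \in `[(- 1)%R, 1%R]%R]%classic.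
  apply: (@rV_compact _ _ (fun=> `[(- 1 : R), 1]%classic)).
  by move=> _; apply: segment_compact.
apply: subclosed_compact Acl Bc _ => x /Ab xb i /=.
by rewrite in_itv /= -ler_norml xb.
Qed.

Lemma closed_level (T : topologicalType) (f : T -> R) (a : R) :
  continuous f -> closed [set x | f x = a]%classic.
Proof.
move=> fc; apply: (preimage_closed (D := [set a]%classic)) => [x _|]; first exact: fc.
exact: closed_eq.
Qed.

Definition seminorm (V : lmodType R) (f : V -> R) : Prop :=
  (forall a x, f (a *: x) = `|a| * f x) /\ (forall x y, f (x + y) <= f x + f y).

Lemma seminorm0 (V : lmodType R) (f : V -> R) : seminorm f -> f 0 = 0.
Proof. by case=> fZ _; rewrite -(scale0r 0) fZ normr0 mul0r. Qed.

Lemma seminorm_ge0 (V : lmodType R) (f : V -> R) x : seminorm f -> 0 <= f x.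
Proof.
move=> fs; have [fZ fD] := fs.
have := fD x (-1 *: x); rewrite fZ normrN1 mul1r scaleN1r subrr seminorm0 //.
lra.
Qed.

Lemma seminormD (V : lmodType R) (f g : V -> R) :
  seminorm f -> seminorm g -> seminorm (fun x => f x + g x).
Proof.
move=> [fZ fD] [gZ gD]; split=> [a x|x y]; first by rewrite fZ gZ mulrDr.
by rewrite addrACA lerD.
Qed.

Lemma seminorm_sum (V : lmodType R) (I : finType) (f : I -> V -> R) :
  (forall i, seminorm (f i)) -> seminorm (fun x => \sum_i f i x).
Proof.
move=> fs; split=> [a x|x y].
  by rewrite mulr_sumr; apply: eq_bigr => i _; have [->] := fs i.
by rewrite -big_split; apply: ler_sum => i _; have [_] := fs i; exact.
Qed.

Lemma seminorm_l1norm (V : lmodType R) m n (L : V -> 'M[R]_(m, n)) :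
  (forall a x, L (a *: x) = a *: L x) -> (forall x y, L (x + y) = L x + L y) ->
  seminorm (fun x => l1norm (L x)).
Proof.
by move=> LZ LD; split=> [a x|x y]; rewrite ?LZ ?LD ?l1normZ ?l1normD.
Qed.

Lemma seminorm_le_l1norm n (f : 'rV[R]_n -> R) : seminorm f ->
  exists2 C, 0 <= C & forall x, f x <= C * l1norm x.
Proof.
move=> fs; have [fZ fD] := fs; exists (\sum_i f (delta_mx 0 i)).
  by apply: sumr_ge0 => i _; exact: seminorm_ge0.
move=> x; rewrite {1}[x]row_sum_delta mulr_suml.
elim/big_rec2: _ => [|i y z _ yz]; first by rewrite seminorm0.
apply: le_trans (fD _ _) _; apply: lerD => //.
by rewrite fZ mulrC ler_wpM2l ?le_l1norm //; exact: seminorm_ge0.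
Qed.

Lemma seminorm_continuous n (f : 'rV[R]_n -> R) : seminorm f -> continuous f.
Proof.
move=> fs x; have [C C0 fC] := seminorm_le_l1norm fs; have [fZ fD] := fs.
apply/(@cvgrPdist_le R R^o _ (nbhs x)) => e e0.
have C1 : 0 < C + 1 by rewrite ltr_wpDl.
have := l1norm_near x (divr_gt0 e0 C1); apply: filterS => y.
rewrite ler_pdivlMr // mulrDr mulr1 => yx.
have {}yx : C * l1norm (y - x) <= e.
  by apply: le_trans yx; rewrite mulrC lerDl l1norm_ge0.
apply: le_trans yx.
have fN z : f (- z) = f z by rewrite -scaleN1r fZ normrN1 mul1r.
apply: le_trans (fC _).
rewrite ler_norml; apply/andP; split.
  by have := fD x (y - x); rewrite addrC subrK; lra.
have := fD y (x - y); rewrite addrC subrK -opprB fN; lra.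
Qed.

(** On the compact unit sphere of [l1norm] the continuous [f] has a positive minimum, while [g] is
    bounded by a multiple of [l1norm]. *)
Lemma norm_dominates_rV n (f g : 'rV[R]_n -> R) : seminorm f -> seminorm g ->
  (forall x, f x = 0 -> x = 0) ->
  exists2 C, 0 < C & forall x, g x <= C * f x.
Proof.
move=> fs gs f0; have [K K0 gK] := seminorm_le_l1norm gs.
have g0 : g 0 = 0 by exact: seminorm0.
pose S := [set x : 'rV[R]_n | l1norm x = 1]%classic.
have normalize x : x != 0 -> S ((l1norm x)^-1 *: x).
  move=> x0; have x1 : l1norm x != 0 by apply: contraNneq x0 => /l1norm_eq0 ->.
  by rewrite /S /= l1normZ ger0_norm ?invr_ge0 ?l1norm_ge0 // mulVf.
have [S0|/set0P Sn0] := eqVneq S set0.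
  exists 1 => // x; have [->|x0] := eqVneq x 0.
    by rewrite g0 mul1r seminorm_ge0.
  by have := normalize x x0; rewrite S0.
have Scomp : compact S.
  apply: compact_box_closed; first exact/closed_level/l1norm_continuous.
  by move=> x /= <- i; exact: le_l1norm.
have fc : ({within S, continuous f})%classic.
  by apply: continuous_subspaceT; exact: seminorm_continuous.
have [c cS cmin] := EVT_min_rV Sn0 Scomp fc.
have c0 : 0 < f c.
  rewrite lt_neqAle eq_sym seminorm_ge0 // andbT; apply/eqP => /f0 c0.
  by move: cS; rewrite inE /S /= c0 l1norm0 => /esym/eqP; rewrite oner_eq0.
exists ((K + 1) / f c) => [|x]; first by rewrite divr_gt0 // ltr_pwDr.
have [->|x0] := eqVneq x 0; first by rewrite g0 (seminorm0 fs) mulr0.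
have x1 : 0 < l1norm x.
  by rewrite lt_neqAle l1norm_ge0 andbT eq_sym; apply: contraNneq x0 => /l1norm_eq0 ->.
have := cmin _ (mem_set (normalize x x0)).
rewrite (proj1 fs) ger0_norm ?invr_ge0 ?l1norm_ge0 // mulrC ler_pdivlMr // => fx.
apply: le_trans (gK x) _; rewrite mulrAC ler_pdivlMr // -mulrA.
rewrite [l1norm x * _]mulrC; apply: le_trans (ler_wpM2l K0 fx) _.
by apply: ler_wpM2r; rewrite ?seminorm_ge0 ?lerDl.
Qed.

(** Serves twice: to compare the given norm with the entrywise one, and to turn the injectivity of a
    linear system into an estimate. *)
Lemma norm_dominates (V : vectType R) (f g : V -> R) : seminorm f -> seminorm g ->
  (forall x, f x = 0 -> x = 0) ->
  exists2 C, 0 < C & forall x, g x <= C * f x.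
Proof.
move=> [fZ fD] [gZ gD] f0; pose b := vbasis {:V}.
pose phi (x : 'rV[R]_(\dim {:V})) := \sum_i x 0 i *: b`_i.
have phiZ a x : phi (a *: x) = a *: phi x.
  by rewrite /phi scaler_sumr; apply: eq_bigr => i _; rewrite mxE scalerA.
have phiD x y : phi (x + y) = phi x + phi y.
  by rewrite /phi -big_split; apply: eq_bigr => i _; rewrite mxE scalerDl.
have [|||C C0 fg] := @norm_dominates_rV _ (f \o phi) (g \o phi).
- by split=> [a x|x y]; rewrite /= ?phiZ ?phiD ?fZ ?fD.
- by split=> [a x|x y]; rewrite /= ?phiZ ?phiD ?gZ ?gD.
- move=> x /= /f0 phix; apply/rowP => i; rewrite mxE.
  by have /freeP/(_ (fun i => x 0 i) phix i) := basis_free (vbasisP {:V}).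
exists C => // v; have := fg (\row_i coord b i v).
suff phiK : phi (\row_i coord b i v) = v by rewrite /= phiK.
rewrite [RHS](coord_vbasis (memvf v)); apply: eq_bigr => i _.
by rewrite mxE.
Qed.

End Compactness.

(** * Smallest eigenvalue, definite forms and the Lyapunov equation *)

Section PositiveForms.
Context {R : realType} {n : nat}.
Implicit Types (A B W : 'M[R]_n) (x v : 'cV[R]_n).

Lemma bil_continuous A : continuous (fun x : 'rV[R]_n => bil A x^T x^T).
Proof.
have -> : (fun x : 'rV[R]_n => bil A x^T x^T) =
          (fun x : 'rV[R]_n => \sum_i x 0 i * \sum_j A i j * x 0 j).
  apply/funext => y; rewrite bil_sum_coord; apply: eq_bigr => i _.
  by rewrite !mxE; congr (_ * _); apply: eq_bigr => j _; rewrite mxE.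
apply: sum_continuous => i; apply: mul_continuous; first exact: coord_continuous.
apply: sum_continuous => j; apply: mul_continuous; last exact: coord_continuous.
exact: cst_continuous.
Qed.

(** If [l] is the minimum of the form on the Euclidean unit sphere, [A - l] is positive semidefinite
    and vanishes at the minimiser, which [psd_ker] then puts in its kernel. *)
Lemma min_eigen A : A^T = A -> (0 < n)%N ->
  exists (l : R) (v : 'cV[R]_n), [/\ v != 0, A *m v = l *: v &
                  forall x, l * bil 1%:M x x <= bil A x x].
Proof.
move=> As n0; pose S := [set x : 'rV[R]_n | bil 1%:M x^T x^T = 1]%classic.
have Sn0 : (S !=set0)%classic.
  exists (delta_mx 0 (Ordinal n0)); rewrite /S /= trmx_delta.
  by rewrite -[delta_mx _ _]/(ebase _) bil_ebase mul1mx !mxE !eqxx.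
have Scomp : compact S.
  apply: compact_box_closed; first exact/closed_level/bil_continuous.
  move=> x /= x1 i; rewrite -(ler_pXn2r (n := 2)) ?nnegrE // expr1n.
  rewrite real_normK ?num_real // -x1 bil_sum_coord mul1mx (bigD1 i) //= !mxE.
  by rewrite -expr2 lerDl; apply: sumr_ge0 => j _; rewrite mxE -expr2 sqr_ge0.
have fc : ({within S, continuous (fun x : 'rV[R]_n => bil A x^T x^T)})%classic.
  by apply: continuous_subspaceT; exact: bil_continuous.
have [c] := EVT_min_rV Sn0 Scomp fc; rewrite inE => /= c1 cmin.
set l := bil A c^T c^T in cmin.
have lmin x : l * bil 1%:M x x <= bil A x x.
  have [->|x0] := eqVneq x 0; first by rewrite !bil0l mulr0.
  have xx : 0 < bil 1%:M x x.
    by rewrite lt_neqAle bil1_ge0 andbT eq_sym; apply: contraNneq x0 => /bil1_eq0 ->.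
  pose s := Num.sqrt (bil 1%:M x x).
  have s2 : s^-1 * s^-1 = (bil 1%:M x x)^-1.
    by rewrite -invfM -expr2 sqr_sqrtr // ltW.
  have := cmin (s^-1 *: x^T).
  rewrite inE /S /= !linearZ /= trmxK !bilZl !bilZr !mulrA s2 mulVf ?gt_eqF //.
  by move=> /(_ erefl); rewrite mulrC ler_pdivlMr.
exists l, c^T; split=> //.
  by apply/eqP => c0; move: c1; rewrite /S /= c0 bil0l => /esym/eqP; rewrite oner_eq0.
have Bs : (A - l%:M)^T = A - l%:M by rewrite linearB /= As tr_scalar_mx.
have bB x : bil (A - l%:M) x x = bil A x x - l * bil 1%:M x x.
  by rewrite bilDm bilNm -[l%:M]scalemx1 bil_scale.
have Bp : psd (A - l%:M) by move=> x; rewrite bB subr_ge0.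
have := psd_ker Bs Bp (x := c^T).
rewrite bB c1 mulr1 subrr => /(_ erefl) /eqP.
by rewrite mulmxBl subr_eq0 mul_scalar_mx => /eqP.
Qed.

Definition pd A : Prop := forall x, x != 0 -> 0 < bil A x x.

Lemma pd_coercive A : A^T = A -> pd A ->
  exists2 c, 0 < c & forall x, c * bil 1%:M x x <= bil A x x.
Proof.
move=> As Ap; have [n0|n0] := posnP n.
  exists 1 => // x; have -> : x = 0.
    by apply/colP => i; have := ltn_ord i; rewrite [X in (_ < X)%N]n0.
  by rewrite !bil0l mulr0.
have [l [v [v0 Av lmin]]] := min_eigen As n0; exists l => //.
have vv : 0 < bil 1%:M v v.
  by rewrite lt_neqAle bil1_ge0 andbT eq_sym; apply: contraNneq v0 => /bil1_eq0 ->.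
have : 0 < bil A v v := Ap v v0.
have -> : bil A v v = l * bil 1%:M v v.
  by rewrite -[v in bil A _ v]mul1mx bil_sum_coord mul1mx Av bil_sum_coord mul1mx
             mulr_sumr; apply: eq_bigr => k _; rewrite mxE mulrCA.
by rewrite pmulr_lgt0.
Qed.

Lemma pd_near A : A^T = A -> pd A ->
  \forall e \near at_right (0 : R), forall B, l1norm (B - A) <= e -> pd B.
Proof.
move=> As /(pd_coercive As)[c c0 cA]; near=> e => B Be x x0.
have xx : 0 < bil 1%:M x x.
  by rewrite lt_neqAle bil1_ge0 andbT eq_sym; apply: contraNneq x0 => /bil1_eq0 ->.
have ec : e < c by near: e; exact: nbhs_right_lt.
have := norm_bil (B - A) x; rewrite bilDm bilNm => H.
have : l1norm (B - A) * bil 1%:M x x < c * bil 1%:M x x.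
  by rewrite ltr_pM2r //; exact: le_lt_trans Be ec.
have := cA x; have := ler_normr (bil B x x - bil A x x) (bil A x x - bil B x x).
have : bil A x x - bil B x x <= `|bil B x x - bil A x x|.
  by rewrite distrC ler_norm.
lra.
Unshelve. all: by end_near. Qed.

Lemma psd_gram_eq0 m A (B : 'M[R]_(n, m)) : A^T = A -> psd A ->
  \tr (A *m (B *m B^T)) = 0 -> A *m B = 0.
Proof.
move=> As Ap; rewrite mxtrace_gram => /eqP; rewrite psumr_eq0; last by move=> j _; exact: Ap.
move=> /allP B0; apply: mulmx_eq0_cols => j; apply: psd_ker => //.
by apply/eqP; exact: (B0 j (mem_index_enum _)).
Qed.

(** Sum over the columns [b_k] of [B] of the form of [A] at [b_k + t B_jk e_i]. This is the
    quantitative version of [psd_gram_eq0]: with a good choice of [t], a trace that is merely small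
    bounds every entry of the product. *)
Lemma psd_gram_entry m A (B : 'M[R]_(n, m)) t i j : A^T = A -> psd A ->
  0 <= \tr (A *m (B *m B^T)) + t * (A *m (B *m B^T)) i j *+ 2 +
       t ^+ 2 * (A i i * (B *m B^T) j j).
Proof.
move=> As Ap.
have -> : (A *m (B *m B^T)) i j = \sum_k (A *m col k B) i 0 * B j k.
  by rewrite mulmxA mxE; apply: eq_bigr => k _; rewrite !mxE; congr (_ * _);
     apply: eq_bigr => l _; rewrite mxE.
have -> : (B *m B^T) j j = \sum_k B j k ^+ 2.
  by rewrite mxE; apply: eq_bigr => k _; rewrite mxE expr2.
rewrite mxtrace_gram !mulr_sumr -sumrMnl -!big_split; apply: sumr_ge0 => k _ /=.
have := Ap (col k B + (t * B j k) *: ebase i).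
rewrite !bilDl !bilDr !bilZl !bilZr (bilC _ (ebase i) As) !bil_ebase.
have -> : (A *m ebase i) i 0 = A i i.
  rewrite mxE (bigD1 i) //= mxE !eqxx mulr1 big1 ?addr0 // => l /negPf li.
  by rewrite mxE li mulr0.
by move: (bil _ _ _) ((A *m _) _ _) => x y; congr (0 <= _); ring.
Qed.

(** Multiplying the equation by [W] and taking traces gives [2 tr (A W W^T) = 0]. *)
Lemma lyapunov_eq0 A W : A^T = A -> W^T = W -> psd A ->
  A *m W + W *m A = 0 -> A *m W = 0.
Proof.
move=> As Ws Ap AW; apply: psd_gram_eq0 => //; rewrite Ws.
apply/eqP; rewrite -[_ == 0](@mulrn_eq0 _ _ 2) /=; apply/eqP.
transitivity (\tr ((A *m W + W *m A) *m W)); last by rewrite AW mul0mx mxtrace0.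
by rewrite mulmxDl mxtraceD -[W *m A *m W]mulmxA [\tr (W *m _)]mxtrace_mulC !mulmxA mulr2n.
Qed.

(* At a unit eigenvector [v] of [A] with eigenvalue [l < 0] the equation gives
   [2 l v^T W v = 0], hence [v^T (A + W) v = l < 0]. *)
Lemma lyapunov_psd A W : A^T = A -> W^T = W -> pd (A + W) ->
  A *m W + W *m A = 0 -> psd A.
Proof.
move=> As Ws AWp AW x; have [n0|n0] := posnP n.
  have -> : x = 0.
    by apply/colP => i; have := ltn_ord i; rewrite [X in (_ < X)%N]n0.
  by rewrite bil0l.
have [l [v [v0 Av lmin]]] := min_eigen As n0.
apply: le_trans (lmin x); apply: mulr_ge0; last exact: bil1_ge0.
rewrite leNgt; apply/negP => l0.
have lW : l * bil W v v *+ 2 = 0.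
  have : bil (A *m W + W *m A) v v = 0 by rewrite AW /bil mulmx0 mul0mx mxE.
  rewrite bilDm -!bil_mulmxr Av bilZr (bilC v _ As).
  by rewrite -[bil A _ _]/(((W *m v)^T *m A *m v) 0 0) -mulmxA Av -/(bil 1%:M _ _)
    -scalemxAr mxE trmx_mul Ws mulr2n.
have W0 : bil W v v = 0.
  by move/eqP: lW; rewrite mulrn_eq0 /= mulf_eq0 lt_eqF //= => /eqP.
have := AWp v v0; rewrite bilDm W0 addr0.
rewrite /bil -mulmxA Av -scalemxAr mxE.
have := bil1_ge0 v; rewrite /bil mulmx1 => vv; rewrite ltNge => /negP; apply.
by apply: mulr_le0_ge0 => //; exact: ltW.
Qed.

End PositiveForms.

(** * Schur complements near a positive semidefinite matrix *)

Section PerturbedKernel.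
Context {R : realType} {n : nat}.
Implicit Types (A K Q G : 'M[R]_n) (x z : 'cV[R]_n).

Lemma unitmx_of_ker K : (forall x, K *m x = 0 -> x = 0) -> K \in unitmx.
Proof.
move=> K0; rewrite -unitmx_tr -row_free_unit; apply/inj_row_free => v vK.
by apply: trmx_inj; rewrite trmx0; apply: K0; apply: trmx_inj; rewrite trmx_mul trmxK vK trmx0.
Qed.

Lemma l1norm_le_entries m k (A : 'M[R]_(m, k)) a :
  (forall i j, `|A i j| <= a) -> l1norm A <= (m * k)%:R * a.
Proof.
move=> Aa; rewrite mulr_natl /l1norm mulnC mulrnA -[in leRHS](card_ord m) -sumr_const.
apply: ler_sum => i _; apply: (@le_trans _ _ (\sum_(j < k) a)).
  by apply: ler_sum => j _.
by rewrite sumr_const card_ord.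
Qed.

Lemma l1norm_col m k (A : 'M[R]_(m, k)) j : l1norm (col j A) <= l1norm A.
Proof.
rewrite /l1norm; apply: ler_sum => i _; rewrite big_ord1 mxE (bigD1 j) //= lerDl.
exact: sumr_ge0.
Qed.

Lemma bil1_le_l1norm x : bil 1%:M x x <= l1norm x ^+ 2.
Proof.
rewrite bil_sum_coord mul1mx expr2 {2}/l1norm mulr_sumr; apply: ler_sum => i _.
rewrite big_ord1; apply: le_trans (ler_norm _) _; rewrite normrM ler_wpM2r //.
exact: le_l1norm.
Qed.

Lemma coord_le_bil1 x i : x i 0 ^+ 2 <= bil 1%:M x x.
Proof.
rewrite bil_sum_coord mul1mx (bigD1 i) //= -expr2 lerDl.
by apply: sumr_ge0 => j _; rewrite -expr2 sqr_ge0.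
Qed.

(** For symmetric [A] the first clause says that [G x] and [x - G x] are orthogonal for the form of
    [A]; the other two say that the form is definite on the remainders. If [A] is positive
    semidefinite, an isotropic [x] is therefore fixed by [G]. *)
Definition form_splitting A G : Prop :=
  [/\ forall x, bil A x x = bil A (G *m x) (G *m x) +
                            bil A (x - G *m x) (x - G *m x),
      forall x, 0 <= bil A (x - G *m x) (x - G *m x) &
      forall x, bil A (x - G *m x) (x - G *m x) = 0 -> x = G *m x].

(* [G x] minimises the form of [A] over [x + ker Q], so that
   [x |-> bil A (G x) (G x)] is the form of a Schur complement of [A]. *)
Lemma schur_splitting A0 Q : A0^T = A0 -> psd A0 -> Q *m Q = Q -> A0 *m Q = 0 ->
  (forall x, A0 *m x = 0 -> Q *m x = x) -> forall d, 0 < d ->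
  \forall e \near at_right (0 : R), forall A, A^T = A -> l1norm (A - A0) <= e ->
  exists G, [/\ G *m Q = G, l1norm (G - Q) <= d & form_splitting A G].
Proof.
move=> A0s A0p QQ A0Q kerA0 d d0; pose P := 1%:M - Q.
have QP : Q *m P = 0 by rewrite mulmxBr mulmx1 QQ subrr.
have PP : P *m P = P by rewrite {1}/P mulmxBl mul1mx QP subr0.
(* On [ker Q], the range of [P], this is the form of [A]. The summand [Q^T Q] makes the matrix
   invertible, so the compression of [A] to [ker Q] is inverted without changing size. *)
pose K A := P^T *m A *m P + Q^T *m Q.
have bilK A x : bil (K A) x x = bil A (P *m x) (P *m x) + bil 1%:M (Q *m x) (Q *m x).
  by rewrite bilDm /bil !trmx_mul mulmx1 !mulmxA.
have Ks A : A^T = A -> (K A)^T = K A.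
  by move=> As; rewrite /K linearD /= !trmx_mul !trmxK As mulmxA.
have Pfix z : Q *m z = 0 -> P *m z = z by move=> Qz; rewrite mulmxBl mul1mx Qz subr0.
have K0pd : pd (K A0).
  move=> x x0; rewrite lt_neqAle eq_sym bilK addr_ge0 ?bil1_ge0 // andbT.
  apply: contra_neq x0 => /eqP; rewrite paddr_eq0 ?bil1_ge0 //.
  move=> /andP[/eqP A0x /eqP/bil1_eq0 Qx].
  move: A0x; rewrite Pfix // => /(psd_ker A0s A0p)/kerA0 <-.
  exact: Qx.
have [c c0 cK] := pd_coercive (Ks _ A0s) K0pd.
have c'0 : 0 < c / 2 by rewrite divr_gt0.
have [L0 L00] : exists L, 0 < L /\ (n * n)%:R * l1norm Q <= L.
  exists ((n * n)%:R * l1norm Q + 1); rewrite lerDl ler01; split=> //.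
  by rewrite ltr_wpDl // mulr_ge0 ?l1norm_ge0.
move: L00 => [L00 QL]; near=> e => A As Ae.
have ec : e <= c / 2 by near: e; exact: nbhs_right_le.
have e0 : 0 <= e by apply: le_trans Ae; exact: l1norm_ge0.
(* The perturbation costs at most half of the coercivity constant. *)
have cA z : Q *m z = 0 -> c / 2 * bil 1%:M z z <= bil A z z.
  move=> Qz; have := cK z; rewrite bilK Pfix // Qz bil0l addr0 => cz.
  have := norm_bil (A - A0) z; rewrite bilDm bilNm distrC => Az.
  have : bil A0 z z - bil A z z <= c / 2 * bil 1%:M z z.
    apply: le_trans (ler_norm _) _; apply: le_trans Az _.
    by apply: ler_wpM2r; [exact: bil1_ge0|exact: le_trans Ae ec].
  lra.
have Ku : K A \in unitmx.
  apply: unitmx_of_ker => x Kx; have : bil (K A) x x = 0 by rewrite /bil -mulmxA Kx mulmx0 mxE.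
  have QPx : Q *m (P *m x) = 0 by rewrite mulmxA QP mul0mx.
  rewrite bilK => xx; have := cA _ QPx; have := bil1_ge0 (P *m x).
  have := bil1_ge0 (Q *m x) => Qx0 Px0 Px.
  have cP : 0 <= c / 2 * bil 1%:M (P *m x) (P *m x) by rewrite mulr_ge0 // ltW.
  have /bil1_eq0 Qx : bil 1%:M (Q *m x) (Q *m x) = 0 by lra.
  have /eqP : c / 2 * bil 1%:M (P *m x) (P *m x) = 0 by lra.
  by rewrite mulf_eq0 gt_eqF //= => /eqP/bil1_eq0; rewrite Pfix.
(* Block elimination: the correction, with values in the range of [P], is the one that gives
   [P^T A G = 0]. *)
pose G := Q - P *m invmx (K A) *m P^T *m A *m Q.
have PAG : P^T *m A *m G = 0.
  have PK : P^T *m K A = P^T *m A *m P.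
    rewrite /K mulmxDr !mulmxA -!trmx_mul PP QP trmx0 !mul0mx addr0.
    by [].
  rewrite mulmxBr !mulmxA -PK -[_ *m K A *m _]mulmxA mulmxV // mulmx1.
  by rewrite -trmx_mul PP subrr.
have GQ : G *m Q = G by rewrite mulmxBl QQ -[X in _ - X]mulmxA QQ.
have QG : Q *m G = Q by rewrite mulmxBr QQ !mulmxA QP !mul0mx subr0.
have AzG z x : Q *m z = 0 -> bil A z (G *m x) = 0.
  move=> Qz; rewrite /bil -[z]Pfix // trmx_mul mulmxA -2![z^T *m _ *m _ *m _]mulmxA.
  by rewrite !mulmxA -[z^T *m _ *m _]mulmxA -[z^T *m _ *m _]mulmxA PAG mulmx0 mul0mx mxE.
have Qz x : Q *m (x - G *m x) = 0 by rewrite mulmxBr mulmxA QG subrr.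
have Gsplit : form_splitting A G.
  split.
  - move=> x; have := Qz x; have : x = (x - G *m x) + G *m x by rewrite subrK.
    move: (x - G *m x) => z xE Qz0; rewrite {1 2}xE bilDl !bilDr.
    by rewrite (bilC (G *m x) z As) !(AzG z) // addr0 add0r addrC.
  - by move=> x; apply: le_trans (cA _ (Qz x)); rewrite mulr_ge0 ?bil1_ge0 // ltW.
  - move=> x xx; apply/eqP; rewrite -subr_eq0; apply/eqP/bil1_eq0.
    have := cA _ (Qz x); rewrite xx pmulr_rle0 // => xx0.
    by apply/eqP; rewrite eq_le xx0 bil1_ge0.
exists G; split=> //.
(* A column [z] of [G - Q] lies in [ker Q], and [A0 Q = 0] leaves only [A - A0] in [bil A z z], so
   coercivity bounds [z] by the perturbation. The square of [(c / 2) z + w] stands in for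
   Cauchy-Schwarz. *)
have entry i j : `|(G - Q) i j| <= e * l1norm Q / (c / 2).
  set z := col j (G - Q).
  have zE : z = G *m delta_mx j 0 - Q *m delta_mx j 0 by rewrite /z colE mulmxBl.
  have Qz0 : Q *m z = 0 by rewrite /z colE mulmxA mulmxBr QG QQ subrr mul0mx.
  pose w := col j ((A - A0) *m Q).
  have zw : bil A z z = - bil 1%:M z w.
    rewrite {2}zE bilDr AzG // add0r -scaleN1r bilZr mulN1r; congr (- _).
    by rewrite /w mulmxBl A0Q subr0 colE /bil mulmx1 !mulmxA.
  have w2 : bil 1%:M w w <= (e * l1norm Q) ^+ 2.
    apply: le_trans (bil1_le_l1norm w) _; rewrite ler_pXn2r ?nnegrE ?mulr_ge0 ?l1norm_ge0 //.
    apply: le_trans (l1norm_col _ _) _; apply: le_trans (l1normM _ _) _.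
    by apply: ler_wpM2r; rewrite ?l1norm_ge0.
  have := cA z Qz0; rewrite zw => h1.
  have := bil1_ge0 ((c / 2) *: z + w).
  rewrite !bilDl !bilDr !bilZl !bilZr (bilC w z (trmx1 _ _)) => h2.
  have h3 : c / 2 * (c / 2 * bil 1%:M z z) <= c / 2 * - bil 1%:M z w.
    by rewrite ler_pM2l.
  have h4 : (c / 2) ^+ 2 * bil 1%:M z z <= (e * l1norm Q) ^+ 2 by rewrite expr2; lra.
  rewrite ler_pdivlMr // -(ler_pXn2r (n := 2)) ?nnegrE //; last 2 first.
  - by rewrite mulr_ge0 // ltW.
  - by rewrite mulr_ge0 ?l1norm_ge0.
  rewrite exprMn real_normK ?num_real // mulrC; apply: le_trans h4.
  rewrite ler_pM2l ?exprn_gt0 //.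
  have -> : (G - Q) i j = z i 0 by rewrite [RHS]mxE.
  exact: coord_le_bil1.
apply: le_trans (l1norm_le_entries entry) _.
have eL : e <= d * (c / 2) / L0.
  by near: e; apply: nbhs_right_le; rewrite divr_gt0 // mulr_gt0.
rewrite mulrA ler_pdivrMr // mulrCA; move: eL; rewrite ler_pdivlMr // => eL.
by apply: le_trans eL; apply: ler_wpM2l.
Unshelve. all: by end_near. Qed.

End PerturbedKernel.

(** * Stability of a face of the completely positive cone *)

Definition nonnegmx {R : realType} m n (B : 'M[R]_(m, n)) : Prop := forall i j, 0 <= B i j.

Lemma nonnegmxM {R : realType} m n k (A : 'M[R]_(m, n)) (B : 'M[R]_(n, k)) :
  nonnegmx A -> nonnegmx B -> nonnegmx (A *m B).
Proof. by move=> A0 B0 i j; rewrite mxE; apply: sumr_ge0 => l _; rewrite mulr_ge0. Qed.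

Lemma bil_gram_ge0 {R : realType} n k (B : 'M[R]_(n, k)) : psd (B *m B^T).
Proof.
move=> x; have -> : bil (B *m B^T) x x = bil 1%:M (B^T *m x) (B^T *m x).
  by rewrite /bil trmx_mul trmxK mulmx1 !mulmxA.
exact: bil1_ge0.
Qed.

(* The faces of the completely positive cone met below have the form
   [{V C V^T | C completely positive}]; [Q = V S] projects onto the span of the
   columns of [V], and [A0] is a positive semidefinite matrix with that kernel. *)
Section FaceStability.
Context {R : realType} {n m : nat}.
Context (V : 'M[R]_(n, m)) (S : 'M[R]_(m, n)) (Q A0 W0 : 'M[R]_n) (r : R).
Let face (Y : 'M[R]_n) := exists k (B : 'M[R]_(m, k)),
  nonnegmx B /\ Y = (V *m B) *m (V *m B)^T.
Context (QE : Q = V *m S) (QV : Q *m V = V).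
Context (V_ge0 : nonnegmx V) (V_gt0 : forall i, exists j, 0 < V i j).
Context (A0s : A0^T = A0) (A0p : psd A0) (A0V : A0 *m V = 0)
  (kerA0 : forall x : 'cV_n, A0 *m x = 0 -> Q *m x = x).
Context (W0s : W0^T = W0) (W0Q : Q *m W0 *m Q^T = W0) (r_gt0 : 0 < r)
  (W0ri : forall Y, Y^T = Y -> Q *m Y *m Q^T = Y -> l1norm (Y - W0) <= r -> face Y).

Let QQ : Q *m Q = Q. Proof. by rewrite {2}QE mulmxA QV. Qed.

Let A0Q : A0 *m Q = 0. Proof. by rewrite QE mulmxA A0V mul0mx. Qed.

Let face_psd Y : face Y -> psd Y.
Proof. by move=> [k [B [_ ->]]]; exact: bil_gram_ge0. Qed.

(** A common zero [x] of both forms lies in the range of [Q], so [W0] minus a small multiple of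
    [x x^T] is still in the face, hence positive semidefinite. Its value at [x] is negative unless
    [x = 0]. *)
Lemma face_center_pd : pd (A0 + W0).
Proof.
have W0p : psd W0 by apply: face_psd; apply: W0ri => //; rewrite subrr l1norm0 ltW.
move=> x x0; rewrite bilDm lt_neqAle eq_sym addr_ge0 ?A0p ?W0p // andbT.
apply: contra_neq x0 => /eqP; rewrite paddr_eq0 ?A0p ?W0p // => /andP[/eqP A0x /eqP W0x].
have Qx := kerA0 (psd_ker A0s A0p A0x).
pose eta := r / (l1norm (x *m x^T) + 1).
have l1 : 0 < l1norm (x *m x^T) + 1 by rewrite ltr_wpDl // l1norm_ge0.
have eta0 : 0 < eta by rewrite divr_gt0.
have : psd (W0 - eta *: (x *m x^T)).
  apply/face_psd/W0ri.
  - by rewrite linearB linearZ /= W0s trmx_mul trmxK.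
  - rewrite mulmxBr mulmxBl W0Q -scalemxAr -scalemxAl; congr (_ - _ *: _).
    by rewrite mulmxA Qx -mulmxA -trmx_mul Qx.
  - rewrite addrAC subrr sub0r l1normN l1normZ (ger0_norm (ltW eta0)) /eta mulrAC ler_pdivrMr //.
    by rewrite ler_pM2l // lerDl.
move=> /(_ x); rewrite bilDm bilNm bil_scale W0x sub0r oppr_ge0 pmulr_rle0 //.
have -> : bil (x *m x^T) x x = bil 1%:M x x ^+ 2.
  rewrite /bil mulmx1 mulmxA -[_ *m _ *m x^T *m x]mulmxA mxE big_ord1 expr2.
  by [].
by rewrite exprn_even_le0 //= => /eqP/bil1_eq0.
Qed.

(* [D] moves every nonzero generator into the relative interior of the orthant;
   as [D^-1] is close to the identity, the face shrunk by [D] still contains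
   [W0] in its relative interior. *)
Lemma shrinking : exists D D' : 'M[R]_n, [/\ D *m D' = 1%:M, Q *m D *m Q = D *m Q,
    Q *m D' *m Q = D' *m Q, l1norm (D' *m W0 *m D'^T - W0) <= r / 2 &
    forall i j, col j V = 0 \/ 0 < (D *m V) i j].
Proof.
(* [T y] is the coordinate sum of [y] times the strictly positive sum [a] of the generators. Since
   [T T = s T], the inverse of [1 - eta T] is [1 + kappa T] with [kappa = eta / (1 - eta s)]. *)
pose u : 'rV[R]_n := const_mx 1; pose a := V *m const_mx 1 : 'cV[R]_n.
pose T := a *m u; pose s := (u *m a) 0 0.
have TT : T *m T = s *: T.
  rewrite /T -mulmxA [u *m _]mulmxA [u *m a]mx11_scalar mul_scalar_mx -/s.
  by rewrite -scalemxAr.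
have QT : Q *m T = T by rewrite /T /a !mulmxA QV.
have a0 i : 0 < a i 0.
  have [j Vij] := V_gt0 i; rewrite mxE (bigD1 j) //= mxE mulr1 ltr_wpDr //.
  by apply: sumr_ge0 => k _; rewrite mxE mulr1.
have s0 : 0 <= s by rewrite /s mxE; apply: sumr_ge0 => i _; rewrite mxE mul1r ltW.
pose M := l1norm (T *m W0 + W0 *m T^T) + l1norm (T *m W0 *m T^T) + 1.
have M0 : 0 < M by rewrite ltr_wpDl // addr_ge0 ?l1norm_ge0.
near (at_right (0 : R)) => eta.
have eta0 : 0 < eta by [].
have eta1 : eta <= 1 by near: eta; exact: nbhs_right_le.
have etar : eta <= r / 2 / M by near: eta; apply: nbhs_right_le; rewrite !divr_gt0.
have etas : eta < (s + 1)^-1 by near: eta; apply: nbhs_right_lt; rewrite invr_gt0 ltr_wpDl.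
have es : 0 < 1 - eta * s.
  rewrite subr_gt0; have s1 : 0 < s + 1 by rewrite ltr_wpDl.
  apply: (@le_lt_trans _ _ (eta * (s + 1))); first by rewrite ler_pM2l // lerDl.
  by rewrite -ltr_pdivlMr // mul1r.
pose kappa := eta / (1 - eta * s).
have kappa0 : 0 < kappa by rewrite divr_gt0.
exists (1%:M + kappa *: T), (1%:M - eta *: T); split.
- move: TT; clearbody T => TT.
  rewrite mulmxBr mulmx1 mulmxDl mul1mx -scalemxAr -scalemxAl TT !scalerA.
  apply/matrixP => i j; rewrite !mxE /kappa; field; exact: lt0r_neq0.
- by rewrite mulmxDr mulmx1 !mulmxDl mul1mx -scalemxAr -scalemxAl QQ QT -scalemxAl.
- by rewrite mulmxBr mulmx1 !mulmxBl mul1mx -scalemxAr -scalemxAl QQ QT -scalemxAl.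
- have -> : (1%:M - eta *: T) *m W0 *m (1%:M - eta *: T)^T - W0 =
      - (eta *: (T *m W0 + W0 *m T^T)) + (eta ^+ 2) *: (T *m W0 *m T^T).
    have -> : (1%:M - eta *: T)^T = 1%:M - eta *: T^T by rewrite linearB linearZ /= trmx1.
    rewrite mulmxBr mulmx1 !mulmxBl mul1mx -!scalemxAl -!scalemxAr !scalerA -expr2.
    move: (T *m W0 *m T^T) (T *m W0) (W0 *m T^T) => Y1 Y2 Y3.
    by apply/matrixP => i j; rewrite !mxE; ring.
  apply: le_trans (l1normD _ _) _.
  rewrite l1normN !l1normZ (ger0_norm (ltW eta0)) (ger0_norm (sqr_ge0 _)).
  apply: (@le_trans _ _ (eta * M)); last by rewrite -ler_pdivlMr.
  rewrite /M !mulrDr mulr1 -addrA lerD2l ler_wpDr ?(ltW eta0) //.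
  by apply: ler_wpM2r; [exact: l1norm_ge0|rewrite expr2 ger_pMl].
- move=> i j; rewrite mulmxDl mul1mx.
  have [Vj|] := eqVneq (col j V) 0; [by left|move=> Vj; right].
  have uV : 0 < (u *m V) 0 j.
    rewrite lt_neqAle eq_sym mxE; apply/andP; split; last first.
      by apply: sumr_ge0 => k _; rewrite mxE mul1r.
    apply: contra_neq Vj => /eqP; rewrite psumr_eq0 => [/allP Vj|k _]; last first.
      by rewrite mxE mul1r.
    apply/colP => k; rewrite !mxE; apply/eqP.
    by have := Vj k (mem_index_enum _); rewrite mxE mul1r.
  rewrite mxE -scalemxAl /T -mulmxA [X in _ + X]mxE ltr_wpDl //.
  by rewrite mulr_gt0 // mxE big_ord1 mulr_gt0.
Unshelve. all: by end_near. Qed.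

(** As [Q] fixes the columns of [D V], one has [G D V = D V + (G - Q) D V]. For [G] close to [Q] the
    correction stays below the positive entries of [D V], and zero columns remain zero. *)
Lemma face_stable_gen (D D' : 'M[R]_n) : Q *m D *m Q = D *m Q ->
  (forall i j, col j V = 0 \/ 0 < (D *m V) i j) ->
  \forall e \near at_right (0 : R), forall A, A^T = A -> l1norm (A - A0) <= e ->
  exists G, [/\ G *m Q = G, nonnegmx (G *m D *m V) & form_splitting A G].
Proof.
move=> QDQ DV; have QDV : Q *m D *m V = D *m V by rewrite -QV !mulmxA QDQ.
have [d d0 dDV] : exists2 d, 0 < d & forall i j,
    0 < (D *m V) i j -> d * l1norm (D *m V) <= (D *m V) i j.
  near (at_right (0 : R)) => d; exists d => //.
  near: d; apply: filter_forall => i; apply: filter_forall => j.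
  have [DVij|] := ltP 0 ((D *m V) i j); last by move=> _; near=> d.
  have L1 : 0 < l1norm (D *m V) + 1 by rewrite ltr_wpDl ?l1norm_ge0.
  near=> d => _; have : d <= (D *m V) i j / (l1norm (D *m V) + 1).
    by near: d; apply: nbhs_right_le; rewrite divr_gt0.
  rewrite ler_pdivlMr //; apply: le_trans; rewrite ler_pM2l ?lerDl //.
near=> e => A As Ae.
have [G [GQ Gd Gsplit]] :
    exists G, [/\ G *m Q = G, l1norm (G - Q) <= d & form_splitting A G].
  by move: A As Ae; near: e; exact: schur_splitting.
exists G; split=> // i j; have [Vj|DVij] := DV i j.
  have : col j (G *m D *m V) = 0 by rewrite !colE -mulmxA -colE Vj mulmx0.
  by move/colP/(_ i); rewrite !mxE => ->.
have -> : G *m D *m V = D *m V + (G - Q) *m (D *m V).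
  by rewrite mulmxBl !mulmxA QDV addrC subrK.
rewrite mxE -lerBlDr sub0r; apply: le_trans (dDV _ _ DVij).
apply: le_trans (ler_norm _) _; rewrite normrN.
apply: le_trans (le_l1norm _ _ _) _; apply: le_trans (l1normM _ _) _.
by apply: ler_wpM2r; rewrite ?l1norm_ge0.
Unshelve. all: by end_near. Qed.

(** The slack [r] around [W0] is shared out: half for the shrinking by [D'], a quarter for [W - W0],
    a quarter for a free term [Z]. The latter is zero in one use and a small rank one matrix in the
    other. *)
Lemma face_near_center (D' : 'M[R]_n) : Q *m D' *m Q = D' *m Q ->
  l1norm (D' *m W0 *m D'^T - W0) <= r / 2 ->
  \forall e \near at_right (0 : R), forall W, W^T = W -> l1norm (W - W0) <= e ->
  forall Z, Z^T = Z -> Q *m Z *m Q^T = Z -> l1norm (D' *m Z *m D'^T) <= r / 4 ->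
  face (D' *m (Q *m W *m Q^T + Z) *m D'^T).
Proof.
move=> QD'Q D'W0; pose L := l1norm D' * l1norm Q.
have L0 : 0 < L ^+ 2 + 1 by rewrite ltr_wpDl ?sqr_ge0.
near=> e => W Ws We Z Zs ZQ Zr.
apply: W0ri.
- by rewrite !trmx_mul trmxK linearD /= !trmx_mul trmxK Ws Zs !mulmxA.
- have D'Y Y : Q *m Y *m Q^T = Y -> Q *m (D' *m Y *m D'^T) *m Q^T = D' *m Y *m D'^T.
    move=> YQ; have QDT : Q^T *m (D'^T *m Q^T) = Q^T *m D'^T.
      by rewrite -!trmx_mul QD'Q.
    by rewrite -YQ !mulmxA QD'Q -!mulmxA QDT.
  apply: D'Y; rewrite mulmxDr mulmxDl ZQ; congr (_ + _).
  by rewrite !mulmxA QQ -!mulmxA -trmx_mul QQ.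
have -> : D' *m (Q *m W *m Q^T + Z) *m D'^T - W0 =
    D' *m Q *m (W - W0) *m (D' *m Q)^T + (D' *m W0 *m D'^T - W0) + D' *m Z *m D'^T.
  rewrite mulmxDr mulmxDl mulmxBr mulmxBl trmx_mul !mulmxA addrAC; congr (_ + _).
  rewrite -[X in _ = _ - X + _](_ : D' *m W0 *m D'^T = _) ?addrA ?subrK //.
  by rewrite -{1}W0Q !mulmxA.
have De : l1norm (D' *m Q *m (W - W0) *m (D' *m Q)^T) <= r / 4.
  apply: (@le_trans _ _ (L ^+ 2 * e)); last first.
    have : e <= r / 4 / (L ^+ 2 + 1) by near: e; apply: nbhs_right_le; rewrite !divr_gt0.
    rewrite ler_pdivlMr // mulrDr mulr1 mulrC; apply: le_trans.
    by rewrite lerDl; apply: le_trans We; exact: l1norm_ge0.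
  have DQ : l1norm (D' *m Q) <= L by exact: l1normM.
  apply: le_trans (l1normM _ _) _; rewrite l1norm_tr expr2 mulrAC.
  apply: ler_pM; rewrite ?l1norm_ge0 //.
  by apply: le_trans (l1normM _ _) _; apply: ler_pM; rewrite ?l1norm_ge0.
apply: le_trans (l1normD _ _) _; have -> : r = r / 4 + r / 2 + r / 4 by field.
by apply: lerD => //; apply: le_trans (l1normD _ _) _; apply: lerD.
Unshelve. all: by end_near. Qed.

(** Once [A W = 0], the columns of [W] are isotropic for [A], hence fixed by [G], and
    [W = G (Q W Q^T) G^T]. The middle factor is [(D V B) (D V B)^T] with [B] nonnegative, so
    [G D V B] is a nonnegative factor of [W]. *)
Lemma face_of_lyapunov :
  \forall e \near at_right (0 : R), forall A W, A^T = A -> W^T = W ->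
  l1norm (A - A0) <= e -> l1norm (W - W0) <= e -> A *m W + W *m A = 0 ->
  psd A /\ exists k (B : 'M[R]_(n, k)), nonnegmx B /\ W = B *m B^T.
Proof.
have [D [D' [DD' QDQ QD'Q D'W0 DV]]] := shrinking.
have As0 : (A0 + W0)^T = A0 + W0 by rewrite linearD /= A0s W0s.
have [d d0 dpd] : exists2 d, 0 < d & forall B, l1norm (B - (A0 + W0)) <= d -> pd B.
  near (at_right (0 : R)) => d; exists d => //.
  by near: d; exact: pd_near As0 face_center_pd.
near=> e => A W As Ws Ae We AW.
have ed : e <= d / 2 by near: e; apply: nbhs_right_le; rewrite divr_gt0.
have AWp : pd (A + W).
  apply: dpd; rewrite opprD addrACA; apply: le_trans (l1normD _ _) _; lra.
have Ap : psd A := lyapunov_psd As Ws AWp AW.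
split=> //; have AW0 : A *m W = 0 by apply: lyapunov_eq0.
have GE : exists G, [/\ G *m Q = G, nonnegmx (G *m D *m V) & form_splitting A G].
  by move: A As Ae {AW AWp Ap AW0}; near: e; apply: face_stable_gen.
have [G [GQ GDV [Gsplit G_ge0 G0]]] := GE.
have [k [B [B0 BE]]] : face (D' *m (Q *m W *m Q^T + 0) *m D'^T).
  have Z0 : l1norm (D' *m 0 *m D'^T) <= r / 4.
    by rewrite mulmx0 mul0mx l1norm0 divr_ge0 // ltW.
  have ZQ : Q *m 0 *m Q^T = 0 by rewrite mulmx0 mul0mx.
  move: (0 : 'M[R]_n) (trmx0 R n n) ZQ Z0.
  by move: W Ws We {AW AWp AW0}; near: e; exact: face_near_center.
have GW : G *m W = W.
  apply/eqP; rewrite -subr_eq0 -{2}[W]mul1mx -mulmxBl; apply/eqP.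
  apply: mulmx_eq0_cols => j; rewrite mulmxBl mul1mx -G0 ?subrr //.
  have Aw : bil A (col j W) (col j W) = 0.
    by rewrite /bil -mulmxA colE [A *m _]mulmxA AW0 mul0mx mulmx0 mxE.
  apply/eqP; rewrite eq_le G_ge0 andbT -Aw [leRHS]Gsplit lerDr.
  exact: Ap.
exists k, (G *m D *m V *m B); split; first exact: nonnegmxM.
have WG : W *m G^T = W by rewrite -{1}Ws -trmx_mul GW Ws.
have WE : W = G *m (Q *m W *m Q^T) *m G^T.
  by rewrite !mulmxA GQ GW -mulmxA -trmx_mul GQ WG.
rewrite {1}WE; transitivity (G *m (D *m (D' *m (Q *m W *m Q^T + 0) *m D'^T) *m D^T) *m G^T).
  rewrite addr0; congr (_ *m _ *m _); rewrite !mulmxA DD' mul1mx.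
  by rewrite -[_ *m D'^T *m D^T]mulmxA -trmx_mul DD' trmx1 mulmx1.
by rewrite BE !trmx_mul !mulmxA.
Unshelve. all: by end_near. Qed.

(** By the splitting, only [bil A (G x) (G x)] could be negative. With [y = Q x], the matrix
    [Q B B^T Q^T + eta y y^T] is [(D V C) (D V C)^T], and its image under [G] pairs nonnegatively
    with the copositive [A]. The image of the [B] part pairs nonpositively, since dropping the
    remainders can only lower the zero trace. Hence [eta * bil A (G x) (G x) >= 0]. *)
Lemma face_of_orthogonal :
  \forall e \near at_right (0 : R), forall A k (B : 'M[R]_(n, k)), A^T = A ->
  (forall x, nonneg x -> 0 <= bil A x x) -> nonnegmx B ->
  l1norm (A - A0) <= e -> l1norm (B *m B^T - W0) <= e ->
  \tr (A *m (B *m B^T)) = 0 -> A *m B = 0.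
Proof.
have [D [D' [DD' QDQ QD'Q D'W0 DV]]] := shrinking.
near=> e => A k B As Acop B0 Ae Be trAB.
apply: psd_gram_eq0 => // x.
have GE : exists G, [/\ G *m Q = G, nonnegmx (G *m D *m V) & form_splitting A G].
  by move: A As Ae {Acop trAB}; near: e; apply: face_stable_gen.
have [G [GQ GDV [Gsplit G_ge0 _]]] := GE.
rewrite Gsplit; apply: addr_ge0 => //.
pose y := Q *m x; pose M := l1norm (D' *m (y *m y^T) *m D'^T).
have Qy : Q *m y = y by rewrite mulmxA QQ.
have M0 : 0 < M + 1 by rewrite ltr_wpDl ?l1norm_ge0.
pose eta := r / 4 / (M + 1); have eta0 : 0 < eta by rewrite !divr_gt0.
have [l [C [C0 CE]]] :
    face (D' *m (Q *m (B *m B^T) *m Q^T + eta *: (y *m y^T)) *m D'^T).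
  have Zs : (eta *: (y *m y^T))^T = eta *: (y *m y^T).
    by rewrite linearZ /= trmx_mul trmxK.
  have ZQ : Q *m (eta *: (y *m y^T)) *m Q^T = eta *: (y *m y^T).
    rewrite -scalemxAr -scalemxAl; congr (_ *: _).
    by rewrite mulmxA Qy -mulmxA -trmx_mul Qy.
  have Zr : l1norm (D' *m (eta *: (y *m y^T)) *m D'^T) <= r / 4.
    rewrite -scalemxAr -scalemxAl l1normZ (ger0_norm (ltW eta0)) -/M.
    by rewrite /eta mulrAC ler_pdivrMr // ler_pM2l ?divr_gt0 // lerDl.
  have Ws : (B *m B^T)^T = B *m B^T by rewrite trmx_mul trmxK.
  move: (eta *: (y *m y^T)) Zs ZQ Zr.
  move: (B *m B^T) Ws Be {trAB}.
  by near: e; exact: face_near_center.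
have YE : Q *m (B *m B^T) *m Q^T + eta *: (y *m y^T) =
    (D *m V *m C) *m (D *m V *m C)^T.
  transitivity (D *m (D' *m (Q *m (B *m B^T) *m Q^T + eta *: (y *m y^T)) *m D'^T) *m D^T).
    by rewrite !mulmxA DD' mul1mx -[_ *m D'^T *m D^T]mulmxA -trmx_mul DD' trmx1 mulmx1.
  by rewrite CE !trmx_mul !mulmxA.
have : 0 <= \tr (A *m ((G *m (D *m V *m C)) *m (G *m (D *m V *m C))^T)).
  rewrite mxtrace_gram; apply: sumr_ge0 => j _; apply: Acop => i; rewrite mxE !mulmxA.
  exact: nonnegmxM.
rewrite [(G *m _)^T]trmx_mul -mulmxA [_ *m (_ *m G^T)]mulmxA -YE.
rewrite mulmxDl mulmxDr mulmxDr mxtraceD.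
have -> : \tr (A *m (G *m (Q *m (B *m B^T) *m Q^T *m G^T))) =
          \sum_j bil A (G *m col j B) (G *m col j B).
  have -> : G *m (Q *m (B *m B^T) *m Q^T *m G^T) = (G *m B) *m (G *m B)^T.
    by rewrite -{3 4}GQ !trmx_mul !mulmxA.
  by rewrite mxtrace_gram; apply: eq_bigr => j _; rewrite !colE mulmxA.
have -> : \tr (A *m (G *m (eta *: (y *m y^T) *m G^T))) = eta * bil A (G *m x) (G *m x).
  rewrite -scalemxAl -!scalemxAr mxtraceZ; congr (_ * _).
  have -> : G *m (y *m y^T *m G^T) = (G *m x) *m (G *m x)^T.
    by rewrite -{3 4}GQ /y !trmx_mul !mulmxA.
  by rewrite mxtrace_gram big_ord1 !col_id.
have trG : \sum_j bil A (G *m col j B) (G *m col j B) <= 0.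
  rewrite -[leRHS]trAB mxtrace_gram; apply: ler_sum => j _; rewrite [leRHS]Gsplit lerDl.
  exact: G_ge0.
move=> h; rewrite -(pmulr_rge0 _ eta0); lra.
Unshelve. all: by end_near. Qed.

End FaceStability.

(** * Zeros of a copositive matrix *)

Section ConvexHulls.
Context {R : realType} {V : lmodType R}.

Lemma sub_convex_hull (A : set V) x : A x -> convex_hull A x.
Proof.
move=> Ax; exists 1%N, (fun=> 1), (fun=> x); split=> //.
- by rewrite big_ord1.
- by rewrite big_ord1 scale1r.
Qed.

(** In a convex combination for [x], a generator of weight strictly between 0 and 1 and the
    normalised rest form a segment through [x]; extremality collapses it. *)
Lemma vertices_convex_hull (A : set V) x : vertices (convex_hull A) x -> A x.
Proof.
move=> [[n [c [a [c0 c1 Aa xE]]]] xext].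
have [i ci] : exists i, 0 < c i.
  apply: contrapT => H; have /eqP := c1; rewrite big1 => [|i _].
    by rewrite eq_sym oner_eq0.
  by apply/eqP; rewrite eq_le c0 andbT leNgt; apply/negP => ci; apply: H; exists i.
have c1E : \sum_(j | j != i) c j = 1 - c i.
  by have := c1; rewrite (bigD1 i) //= => <-; rewrite addrAC subrr add0r.
have : c i <= 1 by rewrite -subr_ge0 -c1E; apply: sumr_ge0.
rewrite le_eqVlt => /orP[/eqP ci1|ci1].
  suff -> : x = a i by [].
  move: c1E; rewrite ci1 subrr => /eqP; rewrite psumr_eq0 // => /allP cj0.
  rewrite xE (bigD1 i) //= ci1 scale1r big1 ?addr0 // => j ji.
  by have := cj0 j (mem_index_enum _); rewrite ji => /eqP ->; rewrite scale0r.
have ci1' : 0 < 1 - c i by rewrite subr_gt0.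
pose c' j := if j == i then 0 else c j / (1 - c i).
have [||||<- //] := xext (a i) (\sum_j c' j *: a j) (c i).
- exact: sub_convex_hull.
- exists n, c', a; split=> //.
    by move=> j; rewrite /c'; case: eqP => // _; rewrite divr_ge0 ?c0 ?ltW.
  rewrite (bigD1 i) //= {1}/c' eqxx add0r.
  rewrite (eq_bigr (fun j => c j / (1 - c i))) => [|j /negPf ji]; last by rewrite /c' ji.
  by rewrite -mulr_suml c1E divff // gt_eqF.
- by rewrite ci.
- rewrite xE (bigD1 i) //=; congr (_ + _).
  rewrite [in RHS](bigD1 i) //= {1}/c' eqxx scale0r add0r scaler_sumr.
  apply: eq_bigr => j /negPf ji; rewrite /c' ji scalerA mulrCA divff ?mulr1 //.
  by rewrite gt_eqF.
Qed.

End ConvexHulls.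

Section CopositiveZeros.
Context {R : realType} {p m : nat}.
Context (X : 'M[R]_p) (Xs : X^T = X) (Xcop : forall t, nonneg t -> 0 <= bil X t t).
Implicit Types (t u y z d : 'cV[R]_p).

(** A nonnegative zero minimises the form over the orthant; this is the first-order condition in the
    direction [u]. *)
Lemma copositive_zero_ge0 t u : nonneg t -> bil X t t = 0 -> nonneg u -> 0 <= bil X u t.
Proof.
move=> t0 tt u0; apply: (@quadratic_ge0_linear_ge0 _ _ (bil X u u)) => s s0.
have : nonneg (t + s *: u) by move=> k; rewrite !mxE addr_ge0 ?mulr_ge0.
move=> /Xcop; rewrite !bilDl !bilDr !bilZl !bilZr tt (bilC t _ Xs); congr (0 <= _).
by ring.
Qed.

Lemma simplexP t : simplex t <-> nonneg t /\ \sum_k t k 0 = 1.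
Proof.
split=> -[t0 t1]; split=> //; rewrite -t1; apply: eq_bigr => k _; rewrite ger0_norm //.
Qed.

Lemma simplex_scale t : nonneg t -> t != 0 ->
  exists2 a, 0 < a & simplex (a *: t).
Proof.
move=> t0 tn0; have s0 : 0 < \sum_k t k 0.
  rewrite lt_neqAle eq_sym sumr_ge0 // andbT; apply: contra_neq tn0 => /eqP.
  rewrite psumr_eq0 // => /allP tk; apply/colP => k; rewrite mxE; apply/eqP.
  exact: tk (mem_index_enum _).
exists (\sum_k t k 0)^-1; first by rewrite invr_gt0.
apply/simplexP; split; first by move=> k; rewrite mxE mulr_ge0 // invr_ge0 ltW.
rewrite (eq_bigr (fun k => (\sum_k t k 0)^-1 * t k 0)) => [|k _]; last by rewrite mxE.
by rewrite -mulr_sumr mulVf // gt_eqF.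
Qed.

Lemma hull_zeros y : convex_hull (zeros X) y ->
  [/\ nonneg y, \sum_k y k 0 = 1 & forall u, nonneg u -> 0 <= bil X u y].
Proof.
move=> [n [c [a [c0 c1 Za ->]]]]; split.
- move=> k; rewrite summxE; apply: sumr_ge0 => i _; rewrite mxE mulr_ge0 //.
  by have [/simplexP[]] := Za i.
- rewrite (eq_bigr (fun k => \sum_i c i * a i k 0)) => [|k _]; last first.
    by rewrite summxE; apply: eq_bigr => i _; rewrite mxE.
  rewrite exchange_big -c1; apply: eq_bigr => i _; rewrite -mulr_sumr.
  by have [/simplexP[_ ->] _] := Za i; rewrite mulr1.
- move=> u u0; rewrite bil_sumr; apply: sumr_ge0 => i _; rewrite bilZr mulr_ge0 //.
  by have [/simplexP[a0 _] aa] := Za i; apply: copositive_zero_ge0.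
Qed.

(** Ratio test: [l] is the first step at which a decreasing coordinate reaches zero. *)
Lemma shrink_supp t d : nonneg t -> supp d \subset supp t -> (exists k, d k 0 < 0) ->
  exists l, [/\ 0 < l, nonneg (t + l *: d) & (#|supp (t + l *: d)| < #|supp t|)%N].
Proof.
move=> t0 /fintype.subsetP dt [k0 dk0].
case: (@arg_minP _ _ _ k0 (fun k => d k 0 < 0) (fun k => t k 0 / - d k 0) dk0) => k dk kmin.
have tk : 0 < t k 0.
  by rewrite lt_neqAle eq_sym t0 andbT; have := dt k; rewrite !inE lt_eqF // => ->.
exists (t k 0 / - d k 0); split.
- by rewrite divr_gt0 // oppr_gt0.
- move=> i; rewrite !mxE; have [di|di] := leP 0 (d i 0).
    by rewrite addr_ge0 // mulr_ge0 // divr_ge0 // oppr_ge0 ltW.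
  have := kmin i di; rewrite ler_pdivlMr ?oppr_gt0 //; lra.
- apply/proper_card/properP; split.
    apply/fintype.subsetP => i; rewrite !inE !mxE; apply: contraNneq => ti0.
    have : i \notin supp d by apply: (contra (dt i)); rewrite inE ti0 eqxx.
    by rewrite inE negbK ti0 => /eqP ->; rewrite mulr0 addr0.
  exists k; first by rewrite inE gt_eqF.
  rewrite inE negbK !mxE.
  by apply/eqP; field; rewrite lt_eqF.
Qed.

Lemma exists_lt0 d : d != 0 -> \sum_k d k 0 = 0 -> exists k, d k 0 < 0.
Proof.
move=> d0 d1; apply: contrapT => H; move/negP: d0; apply.
have dge k : 0 <= d k 0 by rewrite leNgt; apply/negP => dk; apply: H; exists k.
move/eqP: d1; rewrite psumr_eq0 // => /allP dk.
by apply/eqP/colP => k; rewrite mxE; apply/eqP/dk/mem_index_enum.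
Qed.

Context (tau : 'I_m -> 'cV[R]_p) (tauP : enumerates_vertices X tau).

Definition vertex_mx : 'M[R]_(p, m) := \matrix_(k, j) tau j k 0.

Lemma vertex_mx_mul c : vertex_mx *m c = \sum_j c j 0 *: tau j.
Proof.
apply/colP => k; rewrite summxE mxE; apply: eq_bigr => j _.
by rewrite !mxE mulrC.
Qed.

Lemma tau_zero j : zeros X (tau j).
Proof.
have [_ tauE] := tauP; apply: vertices_convex_hull.
by rewrite -tauE; exists j.
Qed.

Lemma tau_ge0 j : nonneg (tau j). Proof. by have [/simplexP[]] := tau_zero j. Qed.

Lemma bil_tau_ge0 j u : nonneg u -> 0 <= bil X u (tau j).
Proof. by have [/simplexP[t0 _] tt] := tau_zero j; apply: copositive_zero_ge0. Qed.

(* A zero that is not a vertex lies strictly inside a segment of zeros, which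
   extends on both sides to zeros of smaller support. *)
Lemma zeros_conic t : zeros X t -> exists2 c, nonneg c & t = vertex_mx *m c.
Proof.
have [n le_n] := ubnP #|supp t|; elim: n t le_n => // n IHn t le_n Zt.
have [tv|tv] := pselect (vertices (convex_hull (zeros X)) t).
  have [_ tauE] := tauP; move: tv; rewrite -tauE => -[j _ <-].
  exists (delta_mx j 0) => [k|]; first by rewrite mxE ler0n.
  rewrite vertex_mx_mul (bigD1 j) //= mxE !eqxx scale1r big1 ?addr0 // => i /negPf ij.
  by rewrite mxE ij scale0r.
have [y [z [a [yH zH a01 tE yz]]]] : exists y z a,
    [/\ convex_hull (zeros X) y, convex_hull (zeros X) z, 0 < a < 1,
        t = a *: y + (1 - a) *: z & ~ (y = t /\ z = t)].
  apply: contrapT => H; apply: tv; split; first exact: sub_convex_hull.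
  move=> y z a yH zH a01 tE; apply: contrapT => yz; apply: H.
  by exists y, z, a.
have [/simplexP[t0 t1] tt] := Zt; have /andP[a0 a1] := a01.
have [y0 y1 yge] := hull_zeros yH; have [z0 z1 zge] := hull_zeros zH.
have b0 : 0 < 1 - a by rewrite subr_gt0.
(* [y] and [z] are only known to lie in the convex hull of the zeros. They are isotropic because
   [bil X t t = 0] expands into nonnegative terms with positive weights. *)
have [yy yz0 zz] : [/\ bil X y y = 0, bil X y z = 0 & bil X z z = 0].
  have := tt; rewrite tE !bilDl !bilDr !bilZl !bilZr (bilC z y Xs) => /eqP.
  rewrite !paddr_eq0 ?addr_ge0 ?mulr_ge0 ?(ltW a0) ?(ltW b0) ?yge ?zge //.
  rewrite !mulf_eq0 (gt_eqF a0) (gt_eqF b0) /=.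
  by move=> /andP[/andP[/eqP yy /eqP yz'] /andP[_ /eqP zz]].
have zero_comb (l1 l2 : R) : bil X (l1 *: y + l2 *: z) (l1 *: y + l2 *: z) = 0.
  by rewrite !bilDl !bilDr !bilZl !bilZr (bilC z y Xs) yy yz0 zz !mulr0 !addr0.
pose d := y - z.
have d_neq0 : d != 0.
  apply/eqP => /eqP; rewrite subr_eq0 => /eqP yzE; apply: yz.
  by split=> //; rewrite tE yzE -scalerDl addrC subrK scale1r.
have d_sum0 : \sum_k d k 0 = 0.
  rewrite (eq_bigr (fun k => y k 0 - z k 0)) => [|k _]; last by rewrite !mxE.
  by rewrite sumrB y1 z1 subrr.
have dt : supp d \subset supp t.
  apply/fintype.subsetP => k; rewrite !inE; apply: contraNneq => /eqP.
  rewrite tE !mxE paddr_eq0 ?mulr_ge0 ?(ltW a0) ?(ltW b0) // !mulf_eq0.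
  rewrite (gt_eqF a0) (gt_eqF b0) /= => /andP[/eqP -> /eqP ->].
  by rewrite subrr.
have step (e : 'cV[R]_p) (s : R) : e = s *: d -> e != 0 -> exists l c,
    [/\ 0 < l, nonneg c & t + l *: e = vertex_mx *m c].
  move=> eE e0; have et : supp e \subset supp t.
    apply: fintype.subset_trans dt; apply/fintype.subsetP => k; rewrite !inE eE mxE.
    by apply: contraNneq => ->; rewrite mulr0.
  have e_sum0 : \sum_k e k 0 = 0.
    rewrite (eq_bigr (fun k => s * d k 0)) => [|k _]; last by rewrite eE mxE.
    by rewrite -mulr_sumr d_sum0 mulr0.
  have [l [l0 tl0 tl]] := shrink_supp t0 et (exists_lt0 e0 e_sum0).
  have [||c c0 cE] := IHn (t + l *: e); [|split|by exists l, c].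
  - by apply: leq_trans tl _; rewrite -ltnS.
  - apply/simplexP; split=> //.
    rewrite (eq_bigr (fun k => t k 0 + l * e k 0)) => [|k _]; last by rewrite !mxE.
    by rewrite big_split /= -mulr_sumr t1 e_sum0 mulr0 addr0.
  - have -> : t + l *: e = (a + l * s) *: y + (1 - a - l * s) *: z.
      by rewrite tE eE; apply/colP => k; rewrite !mxE; ring.
    exact: zero_comb.
have [l [c [l0 c0 cE]]] := step d 1 (esym (scale1r d)) d_neq0.
have [||l' [c' [l'0 c'0 c'E]]] := step (- d) (-1).
- by rewrite scaleN1r.
- by rewrite oppr_eq0.
have ll : 0 < l + l' by rewrite addr_gt0.
(* The weights make the displacements [l d] and [- l' d] cancel. *)
exists ((l + l')^-1 *: (l' *: c + l *: c')).
  by move=> k; rewrite !mxE mulr_ge0 ?invr_ge0 ?(ltW ll) // addr_ge0 // mulr_ge0 // ltW.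
rewrite -scalemxAr mulmxDr -!scalemxAr -cE -c'E.
by apply/colP => k; rewrite !mxE; field; rewrite gt_eqF.
Qed.

Lemma nonneg_zero_conic t : nonneg t -> bil X t t = 0 ->
  exists2 c, nonneg c & t = vertex_mx *m c.
Proof.
move=> t0 tt; have [->|tn0] := eqVneq t 0.
  by exists 0 => [k|]; rewrite ?mxE // mulmx0.
have [a a0 at_] := simplex_scale t0 tn0.
have [|c c0 cE] := @zeros_conic (a *: t).
  by split; rewrite // bilZl bilZr tt !mulr0.
exists (a^-1 *: c); first by move=> k; rewrite mxE mulr_ge0 // invr_ge0 ltW.
by rewrite -scalemxAr -cE scalerA mulVf ?scale1r // gt_eqF.
Qed.

(** Adjacency in the graph on the vertices through which conditions b) and c) of a division are
    read. *)
Definition compat (i j : 'I_m) : bool := bil X (tau i) (tau j) == 0.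

Lemma compatC i j : compat i j = compat j i.
Proof. by rewrite /compat bilC. Qed.

(** Both [tau i] and [X tau j] are entrywise nonnegative, so their product vanishes only term by
    term. *)
Lemma compat_supp i j : compat i j = (supp (tau i) \subset M_set X tau j).
Proof.
rewrite /compat bil_sum_coord psumr_eq0; last first.
  by move=> k _; rewrite mulr_ge0 ?tau_ge0 // -bil_ebase bil_tau_ge0 // => l; rewrite mxE ler0n.
apply/allP/fintype.subsetP => H k.
  rewrite !inE bil_ebase => tk; have := H k (mem_index_enum _).
  by rewrite mulf_eq0 (negPf tk).
move=> _; have := H k; rewrite !inE bil_ebase mulf_eq0; case: eqP => //= _; exact.
Qed.

Lemma compat_P_star (I : {set 'I_m}) i :
  (P_star tau I \subset M_set X tau i) = [forall j in I, compat j i].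
Proof.
apply/bigcupsP/forall_inP => H j jI; first by rewrite compat_supp H.
by rewrite -compat_supp H.
Qed.

Lemma compat_pos c : nonneg c -> bil X (vertex_mx *m c) (vertex_mx *m c) = 0 ->
  forall i j, 0 < c i 0 -> 0 < c j 0 -> compat i j.
Proof.
move=> c0; rewrite vertex_mx_mul bil_suml => /eqP.
have ge i j : 0 <= bil X (c i 0 *: tau i) (c j 0 *: tau j).
  by rewrite bilZl bilZr !mulr_ge0 // bil_tau_ge0 //; exact: tau_ge0.
rewrite psumr_eq0 => [/allP H|i _]; last by rewrite bil_sumr sumr_ge0.
move=> i j ci cj; have := H i (mem_index_enum _); rewrite bil_sumr psumr_eq0 //=.
move=> /allP/(_ j (mem_index_enum _)).
by rewrite bilZl bilZr !mulf_eq0 (gt_eqF ci) (gt_eqF cj).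
Qed.

(** * The division as the family of all maximal cliques *)

Context (q : nat) (Js : 'I_q -> {set 'I_m}).

Definition clique (I : {set 'I_m}) := [forall i in I, forall j in I, compat i j].

Lemma cliqueP (I : {set 'I_m}) : reflect {in I &, forall i j, compat i j} (clique I).
Proof.
apply: (iffP forall_inP) => [H i j iI jI|H i iI].
  by have /forall_inP := H i iI; apply.
by apply/forall_inP => j jI; exact: H.
Qed.

Lemma admissible_clique : admissible_division X tau Js -> forall s, clique (Js s).
Proof.
move=> [_ Jcl _] s; apply/cliqueP => i j iI jI.
by have := Jcl s j jI; rewrite compat_P_star => /forall_inP/(_ i iI).
Qed.

(** A vertex [i] outside [Js s] lies in some other [Js s'], and condition c) then exhibits a member
    of [Js s] not adjacent to [i]. *)
Lemma admissible_maximal : admissible_division X tau Js ->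
  forall s i, (forall j, j \in Js s -> compat i j) -> i \in Js s.
Proof.
move=> [Jcov _ Jdist] s i icomp; apply: contrapT => /negP iNs.
have : i \in (\bigcup_s Js s)%SET by rewrite Jcov inE.
move=> /bigcupP[s' _ is']; have ss' : s' != s by apply: contraNneq iNs => <-.
have [_ _ /(_ i)] := Jdist s' s ss'; rewrite inE iNs is' => /(_ erefl).
move=> [j0 [k0 [+ k0i]]]; rewrite inE => /andP[_ /icomp].
by rewrite compat_supp => /fintype.subsetP/(_ k0 k0i) ->.
Qed.

(** Otherwise a maximal clique above [I] differs from every [Js s]. Distinct maximal cliques satisfy
    condition c), so it could be added to the division, against the maximality of [q]. *)
Lemma maximal_clique_cover : maximal_division X tau Js ->
  forall I, clique I -> exists s, I \subset Js s.
Proof.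
move=> [_ Jadm Jmax] I /maxset_exists[C /maxsetP[Ccl Cmax] IC].
apply: contrapT => Hno.
have CJ s : C != Js s by apply: contra_notN Hno => /eqP CE; exists s; rewrite -CE.
have Jcl := admissible_clique Jadm; have Jm := admissible_maximal Jadm.
have Cm i : (forall j, j \in C -> compat i j) -> i \in C.
  move=> icomp; rewrite -(Cmax (i |: C)%SET) ?setU11 ?finset.subsetUr //.
  have ii : compat i i by rewrite /compat; have [_ ->] := tau_zero i.
  apply/cliqueP => a b /setU1P[->|aC] /setU1P[->|bC] //; first exact: icomp.
    by rewrite compatC icomp.
  exact: (cliqueP _ Ccl).
pose ismax (D : {set 'I_m}) := forall i, (forall j, j \in D -> compat i j) -> i \in D.
have sep D E : clique D -> clique E -> ismax D -> ismax E -> D != E ->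
    [/\ D :\: E != finset.set0, E :\: D != finset.set0 &
        forall i0, i0 \in D :\: E -> exists j0 k0,
          [/\ j0 \in E :\: D, k0 \in supp (tau i0) & k0 \notin M_set X tau j0] ].
  move=> Dcl Ecl Dm Em DE.
  have notsub A B : clique B -> ismax A -> A \subset B -> A = B.
    move=> Bcl Am AB; apply/eqP; rewrite finset.eqEsubset AB; apply/fintype.subsetP => i iB.
    by apply: Am => j /(fintype.subsetP AB) jB; exact: (cliqueP _ Bcl).
  split.
  - by rewrite finset.setD_eq0; apply: contra DE => /notsub -> .
  - by rewrite finset.setD_eq0; apply: contra DE => /notsub -> .
  move=> i0; rewrite inE => /andP[i0E i0D].
  have : ~~ [forall j in E, compat i0 j].
    by apply: contra i0E => /forall_inP; exact: Em.
  rewrite negb_forall_in => /exists_inP[j0 j0E]; rewrite compat_supp.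
  move=> /subsetPn[k0 k0i k0j]; exists j0, k0; split=> //.
  rewrite inE j0E andbT; apply: contra k0j => j0D.
  have : compat i0 j0 by exact: (cliqueP _ Dcl).
  by rewrite compat_supp => /fintype.subsetP; apply.
pose Js' (s : 'I_q.+1) := if unlift ord0 s is Some s' then Js s' else C.
have Js'cl s : clique (Js' s) by rewrite /Js'; case: unlift => [s'|] //.
have Js'm s : ismax (Js' s) by rewrite /Js'; case: unlift => [s'|] //; exact: Jm.
have Js'inj s s' : s != s' -> Js' s != Js' s'.
  rewrite /Js'; case: unliftP => [a ->|->]; case: unliftP => [b ->|->] //.
  - rewrite (inj_eq lift_inj) => ab; have [_ _ /(_ a b ab)[dab _ _]] := Jadm.
    by apply: contraNneq dab => ->; rewrite finset.setDv.
  - by move=> _; rewrite eq_sym.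
have : admissible_division X tau Js'.
  split.
  - apply/setP => i; rewrite inE; have [Jcov _ _] := Jadm.
    have : i \in (\bigcup_s Js s)%SET by rewrite Jcov inE.
    move=> /bigcupP[s _ iJ]; apply/bigcupP; exists (lift ord0 s) => //.
    by rewrite /Js' liftK.
  - move=> s i iJ; rewrite compat_P_star; apply/forall_inP => j jJ.
    exact: (cliqueP _ (Js'cl s)).
  - by move=> s s' /Js'inj; apply: sep.
by move=> /Jmax; rewrite ltnn.
Qed.

Lemma zero_in_face : maximal_division X tau Js -> forall t, nonneg t -> bil X t t = 0 ->
  exists s c, [/\ nonneg c, forall j, j \notin Js s -> c j 0 = 0 & t = vertex_mx *m c].
Proof.
move=> Jmax t t0 tt; have [c c0 tE] := nonneg_zero_conic t0 tt.
have /(maximal_clique_cover Jmax)[s /fintype.subsetP sub] : clique [set j | 0 < c j 0].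
  by apply/cliqueP => i j; rewrite !inE; apply: compat_pos; rewrite // -tE.
exists s, c; split=> // j jJ; apply/eqP; rewrite eq_le c0 andbT leNgt.
by apply: contra jJ => cj; apply: sub; rewrite inE.
Qed.

End CopositiveZeros.

(** * Gram matrices and coordinate blocks *)

Section GramMatrices.
Context {R : realType}.

Lemma gramE n k (B : 'M[R]_(n, k)) : B *m B^T = \sum_j col j B *m (col j B)^T.
Proof.
apply/matrixP => a b; rewrite summxE mxE; apply: eq_bigr => j _.
by rewrite !mxE big_ord1 !mxE.
Qed.

Lemma cpP p (U : 'M[R]_p) :
  CP U <-> exists k (B : 'M[R]_(p, k)), nonnegmx B /\ U = B *m B^T.
Proof.
split=> [[n [c [a [c0 aP ->]]]]|[k [B [B0 ->]]]].
  have /choice[t tP] i : exists t : 'cV[R]_p, nonneg t /\ t *m t^T = a i.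
    by have [t t0 tE] := aP i; exists t.
  exists n, (\matrix_(k, i) (Num.sqrt (c i) * t i k 0)); split.
    by move=> k i; rewrite mxE mulr_ge0 ?sqrtr_ge0 //; have [] := tP i.
  rewrite gramE; apply: eq_bigr => i _; have [_ <-] := tP i.
  have -> : col i (\matrix_(k, i) (Num.sqrt (c i) * t i k 0)) = Num.sqrt (c i) *: t i.
    by apply/colP => k; rewrite !mxE.
  by rewrite linearZ /= -scalemxAl -scalemxAr scalerA -expr2 sqr_sqrtr.
exists k, (fun=> 1), (fun j => col j B *m (col j B)^T); split=> //.
  by move=> j; exists (col j B) => // i; rewrite mxE.
by rewrite gramE; apply: eq_bigr => j _; rewrite scale1r.
Qed.

(** From [u v^T + v u^T = (u + v) (u + v)^T - u u^T - v v^T]. It brings in the squares of sums that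
    jj) is about, which are also completely positive for nonnegative columns. *)
Lemma polarization p m (M : 'M[R]_(p, m)) (C : 'M[R]_m) : C^T = C ->
  M *m C *m M^T = \sum_(ij : 'I_m * 'I_m) (C ij.1 ij.2 / 2) *:
    ((col ij.1 M + col ij.2 M) *m (col ij.1 M + col ij.2 M)^T
     - col ij.1 M *m (col ij.1 M)^T - col ij.2 M *m (col ij.2 M)^T).
Proof.
move=> Cs; pose F i j := C i j *: (col i M *m (col j M)^T).
have -> : M *m C *m M^T = \sum_i \sum_j F i j.
  apply/matrixP => a b; rewrite mxE summxE.
  under eq_bigr => j _ do rewrite mxE mulr_suml.
  rewrite exchange_big; apply: eq_bigr => i _; rewrite summxE; apply: eq_bigr => j _.
  by rewrite !mxE big_ord1 !mxE; ring.
rewrite -(pair_bigA _ (fun i j => (C i j / 2) *: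
    ((col i M + col j M) *m (col i M + col j M)^T
     - col i M *m (col i M)^T - col j M *m (col j M)^T))) /=.
have -> : \sum_i \sum_j F i j = 2^-1 *: (\sum_i \sum_j F i j + \sum_i \sum_j F j i).
  rewrite [X in _ + X]exchange_big /=; move: (\sum_i _) => Y.
  by apply/matrixP => a b; rewrite !mxE; field.
rewrite -big_split /= scaler_sumr; apply: eq_bigr => i _.
rewrite -big_split /= scaler_sumr; apply: eq_bigr => j _.
have Cji : C j i = C i j by rewrite -{1}Cs mxE.
rewrite /F Cji -scalerDr scalerA mulrC; congr (_ *: _).
rewrite linearD /= mulmxDl !mulmxDr.
move: (col i M *m (col i M)^T) (col j M *m (col j M)^T) (col i M *m (col j M)^T).
move: (col j M *m (col i M)^T) => Y1 Y2 Y3 Y4.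
by apply/matrixP => a b; rewrite !mxE; ring.
Qed.

(** Weight [a] on [f] and [- a] on the point 0 keep the total weight 1. *)
Lemma affine_hull_add (V : lmodType R) (A : set V) x f a :
  affine_hull A x -> A f -> A 0 -> affine_hull A (x + a *: f).
Proof.
move=> [n [c [b [c1 Ab ->]]]] Af A0.
pose ext (T : Type) (u v : T) (g : 'I_n -> T) (i : 'I_n.+2) : T :=
  if unlift ord0 i is Some i' then
    (if unlift ord0 i' is Some i'' then g i'' else v) else u.
have extE (T : Type) (u v : T) g : ext T u v g ord0 = u /\
    ext T u v g (lift ord0 ord0) = v /\
    forall i, ext T u v g (lift ord0 (lift ord0 i)) = g i.
  by rewrite /ext unlift_none liftK unlift_none; split=> //; split=> // i; rewrite !liftK.
exists n.+2, (ext R a (- a) c), (ext V f 0 b).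
have [c_0 [c_1 c_2]] := extE R a (- a) c; have [b_0 [b_1 b_2]] := extE V f 0 b.
split.
- rewrite !big_ord_recl c_0 c_1 addrA subrr add0r.
  by rewrite -c1; apply: eq_bigr => i _; rewrite c_2.
- move=> i; rewrite /ext; case: unlift => // i'; case: unlift => //.
- rewrite !big_ord_recl c_0 c_1 b_0 b_1 scaler0 add0r addrC; congr (_ + _).
  by apply: eq_bigr => i _; rewrite c_2 b_2.
Qed.

Lemma affine_hull_sum (V : lmodType R) (A : set V) (I : Type) (r : seq I) x
    (a : I -> R) (f : I -> V) :
  affine_hull A x -> (forall i, A (f i)) -> A 0 ->
  affine_hull A (x + \sum_(i <- r) a i *: f i).
Proof.
move=> Ax Af A0; elim: r => [|i r IHr]; first by rewrite big_nil addr0.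
by rewrite big_cons addrCA addrC; apply: affine_hull_add.
Qed.

Lemma sub_affine_hull (V : lmodType R) (A : set V) x : A x -> affine_hull A x.
Proof.
move=> Ax; exists 1%N, (fun=> 1), (fun=> x); split=> //.
- by rewrite big_ord1.
- by rewrite big_ord1 scale1r.
Qed.

Lemma free_blocks (V : vectType R) (S T : eqType) (l : seq S) (t : S -> seq T)
    (f : S -> T -> V) (Z : S -> V) :
  free [seq f s x | s <- l, x <- t s] ->
  (forall s, Z s \in <<[seq f s x | x <- t s]>>%VS) ->
  \sum_(s <- l) Z s = 0 -> forall s, s \in l -> Z s = 0.
Proof.
move=> + ZS; elim: l => // s l IHl /=; rewrite big_cons cat_free => /and3P[_ frl].
move=> /directv_addP XY Zs0.
have lY : \sum_(s' <- l) Z s' \in <<[seq f s x | s <- l, x <- t s]>>%VS.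
  elim: l {IHl frl XY Zs0} => [|s' l IHl]; first by rewrite big_nil mem0v.
  by rewrite big_cons /= span_cat memv_add.
have Zs : Z s = 0.
  apply/eqP; rewrite -memv0 -XY memv_cap ZS.
  have -> : Z s = - \sum_(s' <- l) Z s' by apply/eqP; rewrite -addr_eq0 Zs0.
  by rewrite memvN lY.
move: Zs0; rewrite Zs add0r => Zl s'; rewrite inE => /predU1P[-> //|].
exact: IHl.
Qed.

End GramMatrices.

(** * Selection of coordinates and extension by zero *)

Section Selector.
Context {R : realType} {p : nat} (P : {set 'I_p}).

(** The inclusion of the coordinates in [P]. It turns [principal_submx] and [embed_mx] into matrix
    products, to which trace and Gram identities apply. *)
Definition sel : 'M[R]_(p, #|P|) := \matrix_(k, i) (k == enum_val i)%:R.

Lemma sel_mul_in k (A : 'M[R]_(#|P|, k)) i j : (sel *m A) (enum_val i) j = A i j.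
Proof.
rewrite mxE (bigD1 i) //= mxE eqxx mul1r big1 ?addr0 // => l li.
by rewrite mxE (inj_eq enum_val_inj) eq_sym (negPf li) mul0r.
Qed.

Lemma sel_mul_out k (A : 'M[R]_(#|P|, k)) a j : a \notin P -> (sel *m A) a j = 0.
Proof.
move=> aP; rewrite mxE big1 // => l _; rewrite mxE.
by case: eqP aP => [->|]; rewrite ?enum_valP ?mul0r.
Qed.

Lemma tr_sel_mul k (A : 'M[R]_(p, k)) i j : (sel^T *m A) i j = A (enum_val i) j.
Proof.
rewrite mxE (bigD1 (enum_val i)) //= !mxE eqxx mul1r big1 ?addr0 // => l li.
by rewrite !mxE (negPf li) mul0r.
Qed.

Lemma mul_sel k (A : 'M[R]_(k, p)) i j : (A *m sel) i j = A i (enum_val j).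
Proof. by rewrite -[A *m sel]trmxK trmx_mul mxE tr_sel_mul mxE. Qed.

Lemma sel_tr_sel : sel^T *m sel = 1%:M.
Proof.
by apply/matrixP => i j; rewrite tr_sel_mul !mxE (inj_eq enum_val_inj).
Qed.

Lemma principal_submxE X : principal_submx P X = sel^T *m X *m sel.
Proof. by apply/matrixP => i j; rewrite mul_sel tr_sel_mul mxE. Qed.

Lemma embed_mxE W : embed_mx W = sel *m W *m sel^T.
Proof.
have symE (A : 'M[R]_#|P|) a j : (A *m sel^T) a (enum_val j) = A a j.
  by rewrite -[A *m _]trmxK trmx_mul trmxK mxE sel_mul_in mxE.
apply/matrixP => k l; have [kP|kP] := boolP (k \in P); last first.
  by rewrite embed_mx_out ?(negPf kP) // -mulmxA sel_mul_out.
have [lP|lP] := boolP (l \in P); last first.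
  rewrite embed_mx_out ?(negPf lP) ?andbF // -[_ *m sel^T]trmxK [RHS]mxE.
  by rewrite trmx_mul trmxK sel_mul_out.
rewrite -(enum_rankK_in kP kP) -(enum_rankK_in lP lP) embed_mx_in.
by rewrite -mulmxA sel_mul_in symE.
Qed.

Lemma sel_supported k (A : 'M[R]_(p, k)) :
  (forall a j, a \notin P -> A a j = 0) -> sel *m (sel^T *m A) = A.
Proof.
move=> A0; apply/matrixP => a j; have [aP|aP] := boolP (a \in P).
  by rewrite -(enum_rankK_in aP aP) sel_mul_in tr_sel_mul.
by rewrite sel_mul_out // A0.
Qed.

Lemma sel_ge0 k (A : 'M[R]_(#|P|, k)) : nonnegmx A -> nonnegmx (sel *m A).
Proof. by apply: nonnegmxM => i j; rewrite mxE ler0n. Qed.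

Lemma sel_ge0_cV (y : 'cV[R]_#|P|) : nonneg y -> nonneg (sel *m y).
Proof. by move=> y0 i; apply: sel_ge0 => k j; rewrite ord1. Qed.

Lemma bil_sel X (x : 'cV[R]_#|P|) y :
  bil X (sel *m x) (sel *m y) = bil (principal_submx P X) x y.
Proof. by rewrite principal_submxE /bil trmx_mul !mulmxA. Qed.

(** Difference of squares: [u] is [t] cut down to [P], and the sum is [(t - u)^T X (t + u)] with
    [t - u] supported off [P]. A single sign condition, on [X (t + u)] off [P], thus controls all
    that [u] misses. *)
Lemma bil_split_supp X t : X^T = X ->
  let u := sel *m (sel^T *m t) in
  bil X t t = bil X u u + \sum_(k | k \notin P) t k 0 * (X *m (t + u)) k 0.
Proof.
move=> Xs u; have uin k : k \in P -> u k 0 = t k 0.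
  by move=> kP; rewrite -(enum_rankK_in kP kP) sel_mul_in tr_sel_mul.
have uout k : k \notin P -> u k 0 = 0 by move=> kP; rewrite sel_mul_out.
have -> : \sum_(k | k \notin P) t k 0 * (X *m (t + u)) k 0 = bil X (t - u) (t + u).
  rewrite bil_sum_coord [RHS](bigID (fun k => k \notin P)) /= [RHS]addrC.
  rewrite [X in _ = X + _]big1 ?add0r.
    by apply: eq_bigr => k kP; rewrite [(t - u) k 0]mxE [(- u) k 0]mxE uout // subr0.
  by move=> k; rewrite negbK => kP; rewrite [(t - u) k 0]mxE [(- u) k 0]mxE uin // subrr mul0r.
rewrite bilDl !bilDr -scaleN1r !bilZl (bilC u t Xs); ring.
Qed.

Lemma psd_extend_supp X t : X^T = X -> psd (principal_submx P X) -> nonneg t ->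
  (forall k, k \notin P -> 0 < (X *m (t + sel *m (sel^T *m t))) k 0) -> 0 <= bil X t t.
Proof.
move=> Xs Ap t0 Xt; rewrite bil_split_supp // addr_ge0 //.
  by rewrite bil_sel; exact: Ap.
by apply: sumr_ge0 => k kP; rewrite mulr_ge0 // ltW // Xt.
Qed.

Lemma copositive_zero_supp X t : X^T = X -> (forall u, nonneg u -> 0 <= bil X u u) ->
  nonneg t -> bil X t t = 0 ->
  (forall k, k \notin P -> 0 < (X *m (t + sel *m (sel^T *m t))) k 0) ->
  forall k, k \notin P -> t k 0 = 0.
Proof.
move=> Xs Xcop t0 + Xt k kP; rewrite bil_split_supp // => /eqP.
have s0 l : l \notin P -> 0 <= t l 0 * (X *m (t + sel *m (sel^T *m t))) l 0.
  by move=> lP; rewrite mulr_ge0 // ltW // Xt.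
rewrite paddr_eq0; last 2 first.
- apply: Xcop; apply: sel_ge0_cV => i; rewrite tr_sel_mul; exact: t0.
- exact: sumr_ge0.
move=> /andP[_]; rewrite psumr_eq0 // => /allP/(_ k (mem_index_enum _)).
by rewrite kP mulf_eq0 (gt_eqF (Xt _ kP)) orbF => /eqP.
Qed.

End Selector.

(** * The faces attached to the zeros of a copositive matrix *)

Section FaceDecomposition.
Context {R : realType} {p m q : nat}.
Context (X0 : 'M[R]_p) (X0s : X0^T = X0)
  (X0cop : forall t, nonneg t -> 0 <= bil X0 t t).
Context (tau : 'I_m -> 'cV[R]_p) (tauP : enumerates_vertices X0 tau).
Context (Js : 'I_q -> {set 'I_m}) (JsP : maximal_division X0 tau Js).
Context (Jb : 'I_q -> {set 'I_m}) (JbP : forall s, basis_subset tau (Jb s) (Js s)).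
Context (asm_jj : free (sum_squares tau Jb)).
Context (asm_jjj : forall s j, j \in Js s -> M_set X0 tau j = P_star tau (Js s)).

(** Columns outside [I] are zeroed rather than deleted, so that all faces share one space of
    coefficients. *)
Definition vertices_mx (I : {set 'I_m}) : 'M[R]_(p, m) :=
  \matrix_(k, j) (if j \in I then tau j k 0 else 0).

Lemma col_vertices_mx I j : col j (vertices_mx I) = if j \in I then tau j else 0.
Proof. by apply/colP => k; rewrite !mxE; case: ifP => // _; rewrite mxE. Qed.

Definition face_supp s : {set 'I_p} := P_star tau (Js s).
Definition face_sel s : 'M[R]_(p, #|face_supp s|) := sel (face_supp s).
Definition face_gens s : 'M[R]_(#|face_supp s|, m) := (face_sel s)^T *m vertices_mx (Js s).
Definition face_form s : 'M[R]_#|face_supp s| := principal_submx (face_supp s) X0.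
(** A generalised inverse: composed with the generators it projects onto their span, although they
    may be dependent. *)
Definition face_coord s : 'M[R]_(m, #|face_supp s|) := (pinvmx (face_gens s)^T)^T.
Definition face_proj s : 'M[R]_#|face_supp s| := face_gens s *m face_coord s.

Let E := face_sel.
Let V := face_gens.
Let A0 := face_form.
Let Q := face_proj.
Let T s := vertices_mx (Js s).

Lemma sel_face_gens s : E s *m V s = T s.
Proof.
apply: sel_supported => k j kP; rewrite mxE; case: ifP => // jJ.
apply/eqP; apply: contraNT kP => tk.
by apply/bigcupP; exists j => //; rewrite inE.
Qed.

Lemma face_proj_gens s : Q s *m V s = V s.
Proof.
rewrite /Q /V /face_proj /face_coord; move: (face_gens s) => Vs.
move: (pinvmx _) (mulmxKpV (submx_refl Vs^T)) => K VKV.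
by apply: trmx_inj; rewrite !trmx_mul trmxK mulmxA.
Qed.

Lemma face_gens_ge0 s : nonnegmx (V s).
Proof.
move=> i j; rewrite tr_sel_mul mxE; case: ifP => // _.
exact: tau_ge0 tauP _ _.
Qed.

Lemma face_gens_gt0 s i : exists j, 0 < V s i j.
Proof.
have /bigcupP[j jJ] := enum_valP i; rewrite inE => tj; exists j.
by rewrite tr_sel_mul mxE jJ lt_neqAle eq_sym tj (tau_ge0 tauP).
Qed.

Lemma face_form_sym s : (A0 s)^T = A0 s.
Proof. by rewrite /A0 /face_form principal_submxE !trmx_mul trmxK X0s mulmxA. Qed.

Lemma face_form_gens s : A0 s *m V s = 0.
Proof.
rewrite /A0 /face_form principal_submxE -[sel _]/(E s) -[_ *m E s *m V s]mulmxA sel_face_gens.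
apply: mulmx_eq0_cols => j; rewrite -mulmxA col_vertices_mx; case: ifP => jJ; last first.
  by rewrite !mulmx0.
apply/colP => i; rewrite tr_sel_mul -bil_ebase mxE.
have : enum_val i \in M_set X0 tau j by rewrite (asm_jjj jJ); exact: enum_valP.
by rewrite inE => /eqP.
Qed.

Lemma bil_face_zero s c : bil X0 (T s *m c) (T s *m c) = 0.
Proof.
rewrite -sel_face_gens -mulmxA bil_sel -[principal_submx _ _]/(A0 s).
by apply: bil_ker; rewrite mulmxA face_form_gens mul0mx.
Qed.

Let ones : 'cV[R]_m := const_mx 1.

Lemma face_interior s (x : 'cV[R]_#|face_supp s|) :
  exists2 e, 0 < e & nonneg (V s *m ones + e *: x).
Proof.
near (at_right (0 : R)) => e; exists e => //; near: e; apply: filter_forall => i.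
have a0 : 0 < (V s *m ones) i 0.
  have [j Vij] := face_gens_gt0 i; rewrite mxE (bigD1 j) //= [ones _ _]mxE mulr1 ltr_wpDr //.
  by apply: sumr_ge0 => k _; rewrite [ones _ _]mxE mulr1 face_gens_ge0.
near=> e; rewrite mxE [(e *: x) i 0]mxE.
have xe : e * `|x i 0| <= (V s *m ones) i 0.
  have x1 : 0 < `|x i 0| + 1 by rewrite ltr_wpDl.
  have : e <= (V s *m ones) i 0 / (`|x i 0| + 1).
    by near: e; apply: nbhs_right_le; rewrite divr_gt0.
  rewrite ler_pdivlMr // mulrDr mulr1; apply: le_trans.
  by rewrite lerDl.
have e0 : 0 <= e by [].
have := ler_norm (- x i 0); rewrite normrN => /(ler_wpM2l e0); lra.
Unshelve. all: by end_near. Qed.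

(** The sum of the generators is strictly positive and in the kernel of [A0 s]. Moving from it by
    [e x] stays in the orthant, and copositivity there leaves [e ^+ 2] times the form at [x]. *)
Lemma face_form_psd s : psd (A0 s).
Proof.
move=> x; have [e e0 ge] := face_interior x.
have := X0cop (sel_ge0_cV ge).
rewrite bil_sel -[principal_submx _ _]/(A0 s) !bilDl !bilDr !bilZl !bilZr.
have Aa y : bil (A0 s) y (V s *m ones) = 0.
  by apply: bil_ker; rewrite mulmxA face_form_gens mul0mx.
rewrite (bilC (V s *m ones) x (face_form_sym s)) !Aa !mulr0 !add0r mulrA.
by rewrite pmulr_rge0 // mulr_gt0.
Qed.

(** Added to the sum of the generators, a small multiple of [x] gives a nonnegative zero of [X0], a
    conic combination of vertices. Those of positive weight have support in [face_supp s], so they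
    are adjacent to all of [Js s] and belong to it. *)
Lemma face_form_ker s (x : 'cV[R]_#|face_supp s|) : A0 s *m x = 0 -> Q s *m x = x.
Proof.
move=> Ax; have [e e0 ge] := face_interior x.
set y := V s *m ones + e *: x in ge.
have Ay : A0 s *m y = 0 by rewrite mulmxDr mulmxA face_form_gens mul0mx -scalemxAr Ax scaler0 addr0.
have y0 : nonneg (E s *m y) := sel_ge0_cV ge.
have [|c c0 yE] := nonneg_zero_conic X0s X0cop tauP y0.
  by rewrite bil_sel -[principal_submx _ _]/(A0 s) bil_ker.
have cJ j : j \notin Js s -> c j 0 = 0.
  move=> jJ; apply/eqP; rewrite eq_le c0 andbT leNgt; apply: contra jJ => cj.
  have [_ Jadm _] := JsP.
  apply: (admissible_maximal X0s X0cop tauP Jadm) => i iJ.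
  rewrite (compat_supp X0s X0cop tauP) (asm_jjj iJ); apply/fintype.subsetP => k.
  rewrite inE => tk; apply: contraNT tk => kP.
  have : (vertex_mx tau *m c) k 0 = 0 by rewrite -yE sel_mul_out.
  rewrite vertex_mx_mul summxE => /eqP; rewrite psumr_eq0 => [/allP H|l _]; last first.
    by rewrite mxE mulr_ge0 // (tau_ge0 tauP).
  have := H j (mem_index_enum _); rewrite mxE mulf_eq0 gt_eqF //=.
have TE : vertex_mx tau *m c = T s *m c.
  apply/colP => k; rewrite !mxE; apply: eq_bigr => j _; rewrite !mxE.
  by case: ifPn => // /cJ ->; rewrite !mulr0.
have yV : y = V s *m c.
  by rewrite /V /face_gens -mulmxA -TE -yE mulmxA sel_tr_sel mul1mx.
have xE : x = V s *m (e^-1 *: (c - ones)).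
  rewrite -scalemxAr mulmxBr -yV /y [_ + e *: _]addrC addrK scalerA mulVf ?scale1r //.
  by rewrite gt_eqF.
by rewrite xE mulmxA face_proj_gens.
Qed.

(** Each column of [B] is a zero of [X0], so it lies in the cone of one clique. Columns are sorted
    by such a clique, the others being replaced by zero. *)
Lemma cp_decomposition k (B : 'M[R]_(p, k)) : nonnegmx B -> \tr (X0 *m (B *m B^T)) = 0 ->
  exists C : 'I_q -> 'M[R]_(m, k), (forall s, nonnegmx (C s)) /\
    B *m B^T = \sum_s (T s *m C s) *m (T s *m C s)^T.
Proof.
move=> B0; have colB0 j : nonneg (col j B) by move=> i; rewrite mxE.
rewrite mxtrace_gram => /eqP; rewrite psumr_eq0 => [/allP Bz|j _]; last exact: X0cop.
have /choice[f fP] j : exists sc : 'I_q * 'cV[R]_m, [/\ nonneg sc.2,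
    forall i, i \notin Js sc.1 -> sc.2 i 0 = 0 & col j B = vertex_mx tau *m sc.2].
  have /eqP Bj := Bz j (mem_index_enum _).
  have [s [c [c0 cJ cE]]] := zero_in_face X0s X0cop tauP JsP (colB0 j) Bj.
  by exists (s, c).
exists (fun s => \matrix_(i, j) (if (f j).1 == s then (f j).2 i 0 else 0)); split.
  by move=> s i j; rewrite mxE; case: ifP => // _; have [] := fP j.
pose C s := \matrix_(i, j) (if (f j).1 == s then (f j).2 i 0 else 0).
have colC s j : col j (T s *m C s) = if (f j).1 == s then col j B else 0.
  rewrite colE -mulmxA -colE; have -> : col j (C s) = if (f j).1 == s then (f j).2 else 0.
    by apply/colP => i; rewrite !mxE; case: ifP => // _; rewrite mxE.
  case: eqP => [<-|_]; last by rewrite mulmx0.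
  have [_ fJ ->] := fP j; apply/colP => i; rewrite !mxE; apply: eq_bigr => l _.
  by rewrite !mxE; case: ifPn => // /fJ ->; rewrite !mulr0.
transitivity (\sum_s \sum_j col j (T s *m C s) *m (col j (T s *m C s))^T); last first.
  by apply: eq_bigr => s _; rewrite [RHS]gramE.
rewrite gramE exchange_big; apply: eq_bigr => j _.
rewrite (bigD1 (f j).1) //= colC eqxx big1 ?addr0 // => s /negPf sf.
by rewrite colC eq_sym sf mul0mx.
Qed.

Lemma basis_vertices s : exists D, T s = vertices_mx (Jb s) *m D.
Proof.
have [JbJs Jbas] := JbP s.
have spanE v : v \in <<[seq tau j | j in Jb s]>>%VS -> exists c, v = vertices_mx (Jb s) *m c.
  pose f := linfun (mulmx (vertices_mx (Jb s)) : 'cV[R]_m -> 'cV[R]_p).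
  have sub : (<<[seq tau j | j in Jb s]>> <= limg f)%VS.
    apply/span_subvP => w /mapP[j]; rewrite mem_enum => jJ ->.
    have -> : tau j = f (delta_mx j 0) by rewrite lfunE /= -colE col_vertices_mx jJ.
    exact/memv_img/memvf.
  by move=> /(subvP sub)/memv_imgP[c _ ->]; exists c; rewrite lfunE.
have /choice[c cE] j : exists c, col j (T s) = vertices_mx (Jb s) *m c.
  rewrite col_vertices_mx; case: ifP => jJ; last by exists 0; rewrite mulmx0.
  apply: spanE; have /andP[/eqP -> _] := Jbas.
  by apply: memv_span; apply/mapP; exists j; rewrite ?mem_enum.
exists (\matrix_(i, j) c j i 0); apply/matrixP => k j.
have /colP/(_ k) := cE j; rewrite mxE => ->; rewrite !mxE.
by apply: eq_bigr => i _; rewrite !mxE.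
Qed.

(** Rewritten in the basis [Jb s] and polarized, each summand lies in the span of block [s] of the
    free family of jj), and such spans are independent. *)
Lemma face_direct (C : 'I_q -> 'M[R]_m) : (forall s, (C s)^T = C s) ->
  \sum_s T s *m C s *m (T s)^T = 0 -> forall s, T s *m C s *m (T s)^T = 0.
Proof.
move=> Cs Z0 s; pose Z s := T s *m C s *m (T s)^T.
pose f (s : 'I_q) (ij : 'I_m * 'I_m) := (tau ij.1 + tau ij.2) *m (tau ij.1 + tau ij.2)^T.
apply: (@free_blocks _ _ _ _ (enum 'I_q) (fun s => enum (V_pairs (Jb s))) f Z) => //.
- move=> {}s; have [D TD] := basis_vertices s.
  have -> : Z s = vertices_mx (Jb s) *m (D *m C s *m D^T) *m (vertices_mx (Jb s))^T.
    by rewrite /Z TD trmx_mul !mulmxA.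
  rewrite polarization; last by rewrite !trmx_mul trmxK Cs mulmxA.
  have tauB i j : i \in Jb s -> j \in Jb s ->
      (tau i + tau j) *m (tau i + tau j)^T \in <<[seq f s x | x <- enum (V_pairs (Jb s))]>>%VS.
    move=> iJ jJ; wlog ij : i j iJ jJ / (i <= j)%N => [H|].
      by have /orP[|] := leq_total i j => /H; [exact|rewrite addrC; exact].
    by apply: memv_span; apply/mapP; exists (i, j); rewrite // mem_enum inE iJ jJ.
  have tau2 i : i \in Jb s ->
      tau i *m (tau i)^T \in <<[seq f s x | x <- enum (V_pairs (Jb s))]>>%VS.
    move=> iJ; have := memvZ (4^-1 : R) (tauB i i iJ iJ).
    suff -> : 4^-1 *: ((tau i + tau i) *m (tau i + tau i)^T) = tau i *m (tau i)^T by [].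
    rewrite linearD /= mulmxDl !mulmxDr; move: (tau i *m _) => Y.
    by apply/matrixP => a b; rewrite !mxE; field.
  apply: memv_suml => -[i j] _ /=; apply: memvZ; rewrite !col_vertices_mx.
  case: ifP => iJ; case: ifP => jJ;
    rewrite ?addr0 ?add0r ?trmx0 ?mulmx0 ?mul0mx ?subr0 ?subrr ?mem0v //.
  by rewrite !memvB // ?tauB ?tau2.
- by rewrite -[RHS]Z0 big_enum.
- by rewrite mem_enum.
Qed.

Lemma face_point_cp s k (C : 'M[R]_(m, k)) : nonnegmx C ->
  (CP `&` orthogonal_space X0)%classic ((T s *m C) *m (T s *m C)^T).
Proof.
move=> C0; have TC0 : nonnegmx (T s *m C).
  apply: nonnegmxM => // a j; rewrite mxE; case: ifP => // _; exact: tau_ge0 tauP _ _.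
split; first by apply/cpP; exists k, (T s *m C).
split; first by apply/symmetricmxP; rewrite trmx_mul trmxK.
rewrite /inner mxtrace_gram big1 // => j _.
by rewrite colE -mulmxA bil_face_zero.
Qed.

(** Polarization writes the added term as a signed combination of points of the face, which contains
    0. *)
Lemma affine_hull_face U s (C : 'M[R]_m) : C^T = C ->
  (CP `&` orthogonal_space X0)%classic U ->
  affine_hull (CP `&` orthogonal_space X0)%classic (U + T s *m C *m (T s)^T).
Proof.
move=> Cs FU; set F := (CP `&` orthogonal_space X0)%classic in FU *.
have Fcol c : nonneg c -> F ((T s *m c) *m (T s *m c)^T).
  by move=> c0; apply: face_point_cp => i j; rewrite ord1.
have F0 : F 0.
  by have := Fcol 0; rewrite mulmx0 mul0mx; apply=> i; rewrite mxE.
have delta0 i : nonneg (delta_mx i 0 : 'cV[R]_m) by move=> j; rewrite mxE ler0n.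
rewrite polarization //.
rewrite (eq_bigr (fun ij : 'I_m * 'I_m =>
    (C ij.1 ij.2 / 2) *: ((col ij.1 (T s) + col ij.2 (T s)) *m
                          (col ij.1 (T s) + col ij.2 (T s))^T)
    + (- (C ij.1 ij.2 / 2)) *: (col ij.1 (T s) *m (col ij.1 (T s))^T)
    + (- (C ij.1 ij.2 / 2)) *: (col ij.2 (T s) *m (col ij.2 (T s))^T))); last first.
  by move=> ij _; rewrite !scalerBr !scaleNr.
rewrite !big_split /= !addrA.
have Fcol1 j : F (col j (T s) *m (col j (T s))^T) by rewrite colE; exact: Fcol.
apply: affine_hull_sum => //; apply: affine_hull_sum => //; apply: affine_hull_sum => //.
  exact: sub_affine_hull.
move=> ij; rewrite !colE -mulmxDr; apply: Fcol => j; rewrite mxE.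
by rewrite addr_ge0 ?delta0.
Qed.

Lemma face_sel_bound : exists2 L, 0 < L & forall s, l1norm (E s) * l1norm (E s) <= L.
Proof.
have E0 s : 0 <= l1norm (E s) * l1norm (E s) by rewrite mulr_ge0 ?l1norm_ge0.
exists (\sum_s l1norm (E s) * l1norm (E s) + 1); first by rewrite ltr_wpDl // sumr_ge0.
by move=> s; rewrite (bigD1 s) //= -addrA lerDl addr_ge0 // sumr_ge0.
Qed.

(** Passes strict complementarity on to the blocks. Changing only block [s] of [U0] stays in the
    affine hull, hence for small changes in the face; the result decomposes anew, and [face_direct]
    identifies the changed block with the new one. *)
Lemma face_center (U0 : 'M[R]_p) :
  relative_interior (CP `&` orthogonal_space X0)%classic U0 ->
  exists k (B : 'I_q -> 'M[R]_(m, k)) r, [/\ 0 < r, forall s, nonnegmx (B s),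
    U0 = \sum_s E s *m (V s *m B s *m (V s *m B s)^T) *m (E s)^T &
    forall s Y, Y^T = Y -> Q s *m Y *m (Q s)^T = Y ->
      l1norm (Y - V s *m B s *m (V s *m B s)^T) <= r ->
      exists l (B' : 'M[R]_(m, l)), nonnegmx B' /\ Y = V s *m B' *m (V s *m B')^T].
Proof.
move=> [FU0 ri].
have [/cpP[k [B [B0 U0E]]] [_ trU0]] := FU0.
move: trU0; rewrite /inner U0E => /(cp_decomposition B0)[C [C0 CE]].
have EV s l (D : 'M[R]_(m, l)) :
    E s *m (V s *m D *m (V s *m D)^T) *m (E s)^T = T s *m D *m (T s *m D)^T.
  by rewrite -sel_face_gens !trmx_mul !mulmxA.
have [d d0 dri] : exists2 d, 0 < d & forall Y, l1norm (Y - U0) <= d ->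
    affine_hull (CP `&` orthogonal_space X0)%classic Y ->
    (CP `&` orthogonal_space X0)%classic Y.
  near (at_right (0 : R)) => d; exists d => //; near: d.
  exact: near_l1norm.
have [L L0 sumE] := face_sel_bound.
exists k, C, (d / L); split=> //; first by rewrite divr_gt0.
  by rewrite CE; apply: eq_bigr => s _; rewrite EV.
move=> s Y Ys YQ Yr; set W := V s *m C s *m (V s *m C s)^T in Yr.
have WE : E s *m W *m (E s)^T = T s *m C s *m (T s *m C s)^T by rewrite EV.
pose S := face_coord s.
have YE : E s *m Y *m (E s)^T = T s *m (S *m Y *m S^T) *m (T s)^T.
  rewrite -{1}YQ /Q /face_proj -sel_face_gens -/(V s) -/S.
  by move: (V s) (E s) => Vs Es; rewrite !trmx_mul !mulmxA.
pose U := U0 + T s *m (S *m Y *m S^T - C s *m (C s)^T) *m (T s)^T.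
have UE : U = U0 + E s *m (Y - W) *m (E s)^T.
  rewrite /U; congr (_ + _); rewrite [in RHS]mulmxBr [in RHS]mulmxBl YE WE.
  by rewrite mulmxBr mulmxBl trmx_mul !mulmxA.
have FU : (CP `&` orthogonal_space X0)%classic U.
  apply: dri; last first.
    by apply: affine_hull_face => //; rewrite linearB /= !trmx_mul !trmxK Ys mulmxA.
  rewrite UE addrAC subrr add0r; apply: le_trans (l1normM _ _) _; rewrite l1norm_tr.
  apply: (@le_trans _ _ (L * l1norm (Y - W))); last by rewrite mulrC -ler_pdivlMr.
  apply: (@le_trans _ _ (l1norm (E s) * l1norm (Y - W) * l1norm (E s))).
    by apply: ler_wpM2r; rewrite ?l1norm_ge0 ?l1normM.
  by rewrite mulrAC ler_wpM2r ?l1norm_ge0.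
have [/cpP[l [B' [B'0 UB']]] [_ trU]] := FU.
move: trU; rewrite /inner UB' => /(cp_decomposition B'0)[C' [C'0 C'E]].
pose Z s' := (if s' == s then S *m Y *m S^T else C s' *m (C s')^T) - C' s' *m (C' s')^T.
have Zs s' : (Z s')^T = Z s'.
  by rewrite /Z linearB /=; case: ifP => _; rewrite !trmx_mul !trmxK ?Ys ?mulmxA.
have ZE s' : T s' *m Z s' *m (T s')^T =
    (if s' == s then T s *m (S *m Y *m S^T) *m (T s)^T else T s' *m C s' *m (T s' *m C s')^T)
    - T s' *m C' s' *m (T s' *m C' s')^T.
  rewrite /Z mulmxBr mulmxBl !trmx_mul !mulmxA; congr (_ - _).
  by case: eqP => [->|_]; rewrite !mulmxA.
have := face_direct Zs _ s; rewrite ZE eqxx => H.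
have {H} : T s *m (S *m Y *m S^T) *m (T s)^T - T s *m C' s *m (T s *m C' s)^T = 0.
  apply: H; rewrite (eq_bigr _ (fun s' _ => ZE s')) sumrB -C'E -UB' (bigD1 s) //= eqxx.
  rewrite (eq_bigr (fun s' => T s' *m C s' *m (T s' *m C s')^T)) => [|s' /negPf -> //].
  apply/eqP; rewrite subr_eq0 /U mulmxBr mulmxBl; apply/eqP.
  have -> : T s *m (C s *m (C s)^T) *m (T s)^T = T s *m C s *m (T s *m C s)^T.
    by rewrite trmx_mul !mulmxA.
  rewrite U0E CE [in RHS](bigD1 s) //=.
  by rewrite [RHS]addrC [in RHS]addrA subrK.
move=> /eqP; rewrite subr_eq0 -YE -EV => /eqP YC'.
exists l, (C' s); split=> //.
have ETE : (E s)^T *m E s = 1%:M := sel_tr_sel _.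
have EK M : (E s)^T *m (E s *m M *m (E s)^T) *m E s = M.
  by rewrite !mulmxA ETE mul1mx -mulmxA ETE mulmx1.
by rewrite -[Y]EK YC' EK.
Unshelve. all: by end_near. Qed.

(** Quantitative injectivity. For a solution of the homogeneous system, [A0 w = 0] by
    [lyapunov_eq0], so [w] lives on the span of the generators and [face_direct] makes it vanish;
    norm domination does the rest. *)
Lemma lyapunov_stability : exists2 K, 0 < K &
  forall w : forall s, 'M[R]_#|face_supp s|, (forall s, (w s)^T = w s) ->
  forall s, l1norm (w s) <=
    K * (\sum_s l1norm (A0 s *m w s + w s *m A0 s) +
         l1norm (\sum_s E s *m w s *m (E s)^T)).
Proof.
pose pr s (M : 'M[R]_p) := (E s)^T *m M *m E s.
have prZ s a M : pr s (a *: M) = a *: pr s M by rewrite /pr -scalemxAr -scalemxAl.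
have prD s M M' : pr s (M + M') = pr s M + pr s M' by rewrite /pr mulmxDr mulmxDl.
(* Blocks of different sizes are carried as [p] by [p] matrices in one vector space. [f2] and [f3]
   penalise leaving the block shape and symmetry, which makes [f] definite. *)
pose f1 s (W : {ffun 'I_q -> 'M[R]_p}) := A0 s *m pr s (W s) + pr s (W s) *m A0 s.
pose f2 s (W : {ffun 'I_q -> 'M[R]_p}) := W s - E s *m pr s (W s) *m (E s)^T.
pose f3 s (W : {ffun 'I_q -> 'M[R]_p}) := W s - (W s)^T.
pose f4 (W : {ffun 'I_q -> 'M[R]_p}) := \sum_s W s.
pose f W := \sum_s (l1norm (f1 s W) + l1norm (f2 s W) + l1norm (f3 s W)) + l1norm (f4 W).
pose g (W : {ffun 'I_q -> 'M[R]_p}) := \sum_s l1norm (W s).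
have fs : seminorm f.
  apply: seminormD; last first.
    apply: seminorm_l1norm => [a W|W W']; rewrite /f4.
      by rewrite scaler_sumr; apply: eq_bigr => s _; rewrite ffunE.
    by rewrite -big_split; apply: eq_bigr => s _; rewrite ffunE.
  apply: seminorm_sum => s; apply: seminormD; first apply: seminormD.
  - apply: seminorm_l1norm => [a W|W W']; rewrite /f1 ffunE ?prZ ?prD.
      by rewrite -scalemxAr -scalemxAl scalerDr.
    by rewrite mulmxDr mulmxDl addrACA.
  - apply: seminorm_l1norm => [a W|W W']; rewrite /f2 ffunE ?prZ ?prD.
      by rewrite -scalemxAr -scalemxAl scalerBr.
    by rewrite mulmxDr mulmxDl opprD addrACA.
  - apply: seminorm_l1norm => [a W|W W']; rewrite /f3 ffunE.
      by rewrite linearZ scalerBr.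
    by rewrite linearD opprD addrACA.
have gs : seminorm g.
  apply: seminorm_sum => s.
  by apply: (@seminorm_l1norm _ _ _ _ (fun W : {ffun 'I_q -> 'M[R]_p} => W s))
    => [a W|W W']; rewrite ffunE.
have f0 W : f W = 0 -> W = 0.
  move=> /eqP; rewrite paddr_eq0 ?l1norm_ge0 ?sumr_ge0 // => [|s _]; last first.
    by rewrite !addr_ge0 ?l1norm_ge0.
  move=> /andP[+ /eqP/l1norm_eq0 W0]; rewrite psumr_eq0 => [/allP Ws|s _]; last first.
    by rewrite !addr_ge0 ?l1norm_ge0.
  have {}Ws s : [/\ f1 s W = 0, f2 s W = 0 & f3 s W = 0].
    have := Ws s (mem_index_enum _); rewrite !paddr_eq0 ?addr_ge0 ?l1norm_ge0 //.
    by move=> /andP[/andP[/eqP/l1norm_eq0 ? /eqP/l1norm_eq0 ?] /eqP/l1norm_eq0 ?].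
  have Wsym s : (W s)^T = W s.
    by have [_ _ /eqP] := Ws s; rewrite subr_eq0 => /eqP.
  pose w s := pr s (W s).
  have wsym s : (w s)^T = w s by rewrite /w /pr !trmx_mul trmxK Wsym mulmxA.
  have EwE s : W s = E s *m w s *m (E s)^T.
    by have [_ /eqP + _] := Ws s; rewrite subr_eq0 => /eqP.
  have Aw s : A0 s *m w s = 0.
    have [Lw _ _] := Ws s.
    by apply: lyapunov_eq0 => //; [exact: face_form_sym|exact: face_form_psd].
  have Qw s : Q s *m w s = w s.
    apply/eqP; rewrite -subr_eq0 -{2}[w s]mul1mx -mulmxBl; apply/eqP.
    apply: mulmx_eq0_cols => j; rewrite mulmxBl mul1mx face_form_ker ?subrr //.
    by rewrite colE mulmxA Aw mul0mx.
  clearbody w.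
  pose C s := face_coord s *m w s *m (face_coord s)^T.
  have Cs s : (C s)^T = C s by rewrite /C !trmx_mul trmxK wsym mulmxA.
  have WT s : W s = T s *m C s *m (T s)^T.
    have wQ : w s = Q s *m w s *m (Q s)^T.
      by rewrite Qw -[in RHS](wsym s) -trmx_mul Qw wsym.
    rewrite EwE wQ /C /Q /face_proj -sel_face_gens -/(V s).
    by move: (V s) (E s) (face_coord s) => Vs Es Ss; rewrite !trmx_mul !mulmxA.
  have WT0 := face_direct Cs; rewrite -(eq_bigr _ (fun s _ => WT s)) in WT0.
  have {}WT0 := WT0 W0.
  by apply/ffunP => s; rewrite WT WT0 ffunE.
have [K K0 gf] := norm_dominates fs gs f0.
have [L L0 sumE] := face_sel_bound.
exists (L * K) => [|w wsym s]; first by rewrite mulr_gt0.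
have ETE s' : (E s')^T *m E s' = 1%:M := sel_tr_sel _.
pose W := [ffun s => E s *m w s *m (E s)^T].
have prW s' : pr s' (W s') = w s'.
  by rewrite /pr ffunE !mulmxA ETE mul1mx -mulmxA ETE mulmx1.
have fW : f W = \sum_s l1norm (A0 s *m w s + w s *m A0 s) +
         l1norm (\sum_s E s *m w s *m (E s)^T).
  rewrite /f; congr (_ + _).
    apply: eq_bigr => s' _; rewrite /f1 /f2 /f3 prW ffunE subrr !trmx_mul trmxK wsym mulmxA.
    by rewrite subrr l1norm0 !addr0.
  by congr l1norm; apply: eq_bigr => s' _; rewrite ffunE.
rewrite -fW -mulrA; apply: le_trans (ler_wpM2l (ltW L0) (gf W)).
rewrite -[w s]prW; apply: le_trans (l1normM _ _) _.
apply: (@le_trans _ _ (l1norm (E s) * l1norm (W s) * l1norm (E s))).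
  by apply: ler_wpM2r; rewrite ?l1norm_ge0 // -[X in _ <= X * _]l1norm_tr l1normM.
rewrite mulrAC; apply: ler_pM; rewrite ?mulr_ge0 ?l1norm_ge0 //.
rewrite /g (bigD1 s) //= lerDl; apply: sumr_ge0 => s' _; exact: l1norm_ge0.
Qed.

Lemma face_form_near : exists2 L, 0 < L & forall s X,
  l1norm (principal_submx (face_supp s) X - A0 s) <= L * l1norm (X - X0).
Proof.
have [L L0 sumE] := face_sel_bound; exists L => // s X.
rewrite /A0 /face_form !principal_submxE -mulmxBl -mulmxBr -[sel _]/(E s).
apply: le_trans (l1normM _ _) _.
apply: (@le_trans _ _ (l1norm (E s) * l1norm (X - X0) * l1norm (E s))).
  by apply: ler_wpM2r; rewrite ?l1norm_ge0 // -(l1norm_tr (E s)) l1normM.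
by rewrite mulrAC ler_wpM2r ?l1norm_ge0.
Qed.

(** * Closeness of the blocks and copositivity near the reference pair *)

Context (W0 : forall s, 'M[R]_#|face_supp s|) (W0s : forall s, (W0 s)^T = W0 s)
  (AW0 : forall s, A0 s *m W0 s = 0) (U0 : 'M[R]_p)
  (U0E : U0 = \sum_s E s *m W0 s *m (E s)^T).

Let WA0 s : W0 s *m A0 s = 0.
Proof. by apply: trmx_inj; rewrite trmx_mul trmx0 W0s face_form_sym AW0. Qed.

Let sum_embedB (w : forall s, 'M[R]_#|face_supp s|) :
  \sum_s E s *m (w s - W0 s) *m (E s)^T = \sum_s E s *m w s *m (E s)^T - U0.
Proof. by rewrite U0E -sumrB; apply: eq_bigr => s _; rewrite mulmxBr mulmxBl. Qed.

Let formB s (w : 'M[R]_#|face_supp s|) :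
  A0 s *m (w - W0 s) + (w - W0 s) *m A0 s = A0 s *m w + w *m A0 s.
Proof. by rewrite mulmxBr mulmxBl AW0 WA0 !subr0. Qed.

(** The differences [w s - W0 s] solve the unperturbed system up to an error of order [e] that still
    involves their total size [a]; [c * e <= 1 / 2] absorbs that part. *)
Lemma lyapunov_close d : 0 < d -> \forall e \near at_right (0 : R),
  forall X U (w : forall s, 'M[R]_#|face_supp s|),
  l1norm (X - X0) <= e -> l1norm (U - U0) <= e -> (forall s, (w s)^T = w s) ->
  (forall s, principal_submx (face_supp s) X *m w s +
             w s *m principal_submx (face_supp s) X = 0) ->
  U = \sum_s E s *m w s *m (E s)^T -> forall s, l1norm (w s - W0 s) <= d.
Proof.
move=> d0; have [K K0 stab] := lyapunov_stability.
have [L L0 AL] := face_form_near.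
pose om := \sum_s l1norm (W0 s); pose c := q%:R * K * (2 * L).
have d2 : 0 < d / 2 by rewrite divr_gt0.
near=> e => X U w Xe Ue ws Lw UE.
have e0 : 0 < e by [].
have c2 : c * e <= 1 / 2 by near: e; apply: near_mul_le; rewrite divr_gt0.
have cd : (c * om + q%:R * K) * e <= d / 2 by near: e; apply: near_mul_le.
pose v s := w s - W0 s; have vs s : (v s)^T = v s by rewrite linearB /= ws W0s.
pose a := \sum_s l1norm (v s).
have Av s : l1norm (A0 s *m v s + v s *m A0 s) <= 2 * L * e * (l1norm (v s) + l1norm (W0 s)).
  rewrite formB; have := Lw s; set A := principal_submx (face_supp s) X => LA.
  have -> : A0 s *m w s + w s *m A0 s = - ((A - A0 s) *m w s + w s *m (A - A0 s)).
    by rewrite mulmxBl mulmxBr addrACA LA add0r -opprD opprK.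
  have We : l1norm (w s) <= l1norm (v s) + l1norm (W0 s).
    by apply: le_trans (l1normD _ _); rewrite subrK.
  have Ae : l1norm (A - A0 s) <= L * e.
    by apply: le_trans (AL s X) _; rewrite ler_pM2l.
  have AW : l1norm (A - A0 s) * l1norm (w s) <= L * e * (l1norm (v s) + l1norm (W0 s)).
    by apply: ler_pM; rewrite ?l1norm_ge0.
  rewrite l1normN; apply: le_trans (l1normD _ _) _.
  have := l1normM (A - A0 s) (w s); have := l1normM (w s) (A - A0 s).
  rewrite [l1norm (w s) * _]mulrC; lra.
have vK s : l1norm (v s) <= K * (2 * L * e * (a + om) + e).
  apply: le_trans (stab v vs s) _; rewrite ler_pM2l //; apply: lerD.
    by rewrite /a /om -big_split mulr_sumr; apply: ler_sum => s' _; exact: Av.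
  by rewrite sum_embedB -UE.
have ale : a <= q%:R * (K * (2 * L * e * (a + om) + e)).
  apply: (@le_trans _ _ (\sum_(s < q) K * (2 * L * e * (a + om) + e))).
    exact: ler_sum.
  by rewrite sumr_const card_ord -[leLHS]mulr_natl.
have a0 : 0 <= a by apply: sumr_ge0 => s _; exact: l1norm_ge0.
have ad : a <= d.
  have : c * e * a <= 1 / 2 * a by rewrite ler_wpM2r.
  have -> : c * e * a = q%:R * (K * (2 * L * e * (a + om) + e)) - (c * om + q%:R * K) * e.
    by rewrite /c; ring.
  lra.
move=> s; apply: le_trans ad; rewrite /a (bigD1 s) //= lerDl.
by apply: sumr_ge0 => s' _; exact: l1norm_ge0.
Unshelve. all: by end_near. Qed.

(** The extended blocks are nonnegative with sum [U], which bounds them by [M]; their traces against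
    [A0 s] are then of order [e]. [psd_gram_entry] at [t] and [- t] bounds the entries of
    [A0 s *m w s] by order [e / t + t], so [t] is fixed before [e]. *)
Lemma orthogonal_close d : 0 < d -> \forall e \near at_right (0 : R),
  forall X U k (B : forall s, 'M[R]_(#|face_supp s|, k)),
  l1norm (X - X0) <= e -> l1norm (U - U0) <= e -> (forall s, nonnegmx (B s)) ->
  (forall s, \tr (principal_submx (face_supp s) X *m (B s *m (B s)^T)) = 0) ->
  U = \sum_s E s *m (B s *m (B s)^T) *m (E s)^T ->
  forall s, l1norm (B s *m (B s)^T - W0 s) <= d.
Proof.
move=> d0; have [K K0 stab] := lyapunov_stability.
have [L L0 AL] := face_form_near.
pose N : R := \sum_s (#|face_supp s| * #|face_supp s|)%:R.
pose M := N * (l1norm U0 + 1); pose al := \sum_s l1norm (A0 s).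
have N0 : 0 <= N by apply: sumr_ge0 => s _; exact: ler0n.
have M0 : 0 <= M by rewrite mulr_ge0 // addr_ge0 ?l1norm_ge0.
have al0 : 0 <= al by apply: sumr_ge0 => s _; exact: l1norm_ge0.
have d3 : 0 < d / 3 by rewrite divr_gt0.
have [t t0 td] : exists2 t, 0 < t & K * N * al * M * t <= d / 3.
  near (at_right (0 : R)) => t; exists t => //; near: t; exact: near_mul_le.
near=> e => X U k B Xe Ue B0 trAB UE.
have e0 : 0 < e by [].
have e1 : e <= 1 by near: e; exact: nbhs_right_le.
have ed : K * e <= d / 3 by near: e; exact: near_mul_le.
have etd : K * N * L * M / t * e <= d / 3 by near: e; exact: near_mul_le.
pose w s := B s *m (B s)^T; have ws s : (w s)^T = w s by rewrite /w trmx_mul trmxK.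
have B0T s : nonnegmx (B s)^T by move=> i j; rewrite mxE; exact: B0.
have w0 s : nonnegmx (w s) by apply: nonnegmxM; [exact: B0|exact: B0T].
have E0 s : nonnegmx (E s) by move=> i j; rewrite mxE ler0n.
have ET0 s : nonnegmx (E s)^T by move=> i j; rewrite mxE; exact: E0.
have NE s : (#|face_supp s| * #|face_supp s|)%:R <= N.
  by rewrite /N (bigD1 s) //= lerDl; apply: sumr_ge0 => s' _; exact: ler0n.
have wU s : l1norm (w s) <= M.
  have entry i j : `|w s i j| <= l1norm U0 + 1.
    apply: (@le_trans _ _ (l1norm U)); last first.
      rewrite -[U](subrK U0) addrC; apply: le_trans (l1normD _ _) _.
      by rewrite lerD2l; exact: le_trans Ue e1.
    apply: (le_trans _ (le_l1norm U (enum_val i) (enum_val j))).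
    apply: (le_trans _ (ler_norm _)).
    rewrite (ger0_norm (w0 s i j)) UE summxE (bigD1 s) //=.
    rewrite -[E s *m _ *m _]embed_mxE embed_mx_in lerDl; apply: sumr_ge0 => s' _.
    by apply: nonnegmxM => //; apply: nonnegmxM.
  apply: le_trans (l1norm_le_entries entry) _; apply: ler_wpM2r => //.
  by rewrite addr_ge0 ?l1norm_ge0.
have trA s : \tr (A0 s *m w s) <= L * e * M.
  have -> : \tr (A0 s *m w s) = \tr ((- (principal_submx (face_supp s) X - A0 s)) *m w s).
    by rewrite opprB mulmxBl linearB /= trAB subr0.
  apply: le_trans (mxtrace_le_l1norm _ _) _; rewrite l1normN.
  apply: ler_pM; rewrite ?l1norm_ge0 //.
  by apply: le_trans (AL s X) _; rewrite ler_pM2l.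
have Aw s i j : `|(A0 s *m w s) i j| <= (L * e * M / t + t * (al * M)) / 2.
  have AwM : A0 s i i * w s j j <= al * M.
    apply: (@le_trans _ _ (`|A0 s i i| * `|w s j j|)); first by rewrite -normrM ler_norm.
    apply: ler_pM => //; last by apply: le_trans (wU s); exact: le_l1norm.
    apply: le_trans (le_l1norm (A0 s) i i) _; rewrite /al (bigD1 s) //= lerDl.
    by apply: sumr_ge0 => s' _; exact: l1norm_ge0.
  have H u : 0 <= \tr (A0 s *m w s) + u * (A0 s *m w s) i j *+ 2 + u ^+ 2 * (A0 s i i * w s j j).
    exact: (psd_gram_entry (B s) u i j (face_form_sym s) (@face_form_psd s)).
  have tt : t ^+ 2 * (A0 s i i * w s j j) <= t ^+ 2 * (al * M) by rewrite ler_pM2l // exprn_gt0.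
  have := H t; have := H (- t); rewrite sqrrN => H1 H2.
  have T1 : t * (A0 s *m w s) i j * 2 <= L * e * M + t ^+ 2 * (al * M) by have := trA s; lra.
  have T2 : - (t * (A0 s *m w s) i j) * 2 <= L * e * M + t ^+ 2 * (al * M) by have := trA s; lra.
  rewrite -(ler_pM2l t0).
  have -> : t * ((L * e * M / t + t * (al * M)) / 2) = (L * e * M + t ^+ 2 * (al * M)) / 2.
    by field; exact: lt0r_neq0.
  rewrite -{1}(ger0_norm (ltW t0)) -normrM ler_norml; apply/andP; split; lra.
move=> s; rewrite -/(w s).
pose v s := w s - W0 s; have vs s' : (v s')^T = v s' by rewrite linearB /= ws W0s.
apply: le_trans (stab v vs s) _; rewrite sum_embedB -UE.
have Av s' : l1norm (A0 s' *m v s' + v s' *m A0 s') <=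
    (#|face_supp s'| * #|face_supp s'|)%:R * (L * e * M / t + t * (al * M)).
  rewrite formB; apply: le_trans (l1normD _ _) _.
  have -> : w s' *m A0 s' = (A0 s' *m w s')^T by rewrite trmx_mul ws face_form_sym.
  rewrite l1norm_tr; have := l1norm_le_entries (Aw s'); lra.
apply: (@le_trans _ _ (K * (N * (L * e * M / t + t * (al * M)) + e))).
  rewrite ler_pM2l //; apply: lerD => //.
  by rewrite /N mulr_suml; apply: ler_sum => s' _; exact: Av.
have -> : K * (N * (L * e * M / t + t * (al * M)) + e) =
    K * N * L * M / t * e + K * N * al * M * t + K * e by ring.
lra.
Unshelve. all: by end_near. Qed.

(** Some vertex [tau j] has positive weight in [t], and by jjj) [X0 tau j] is strictly positive
    outside [face_supp s]; the other vertices contribute nonnegatively. *)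
Lemma simplex_near_face (t : 'cV[R]_p) : simplex t -> bil X0 t t = 0 ->
  exists s, sel (face_supp s) *m ((sel (face_supp s))^T *m t) = t /\
  forall k, k \notin face_supp s -> 0 < (X0 *m t) k 0.
Proof.
move=> /simplexP[t0 t1] tt.
have [s [c [c0 cJ tE]]] := zero_in_face X0s X0cop tauP JsP t0 tt.
have TE : t = T s *m c.
  rewrite tE; apply/colP => k; rewrite !mxE; apply: eq_bigr => j _; rewrite !mxE.
  by case: ifPn => // /cJ ->; rewrite !mulr0.
exists s; split.
  rewrite TE -sel_face_gens; rewrite -[sel _]/(E s).
  by rewrite !mulmxA -[_ *m (E s)^T *m E s]mulmxA sel_tr_sel mulmx1.
move=> k kP; have Xt0 j : 0 <= (X0 *m tau j) k 0.
  rewrite -bil_ebase; apply: (bil_tau_ge0 X0s X0cop tauP) => i.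
  by rewrite mxE ler0n.
have [j cj] : exists j, 0 < c j 0.
  apply: contrapT => H; have cz : c = 0.
    apply/colP => j; rewrite mxE; apply/eqP; rewrite eq_le c0 andbT leNgt.
    by apply/negP => cj; apply: H; exists j.
  move: t1; rewrite TE cz mulmx0 big1 => [/eqP|i _]; last by rewrite mxE.
  by rewrite eq_sym oner_eq0.
have jJ : j \in Js s by apply: contraTT cj => /cJ ->; rewrite ltxx.
have -> : (X0 *m t) k 0 = \sum_j c j 0 * (X0 *m tau j) k 0.
  rewrite tE vertex_mx_mul mulmx_sumr summxE; apply: eq_bigr => i _.
  by rewrite -scalemxAr mxE.
rewrite (bigD1 j) //= ltr_wpDr ?sumr_ge0 // => [i _|]; first by rewrite mulr_ge0.
rewrite mulr_gt0 // lt_neqAle eq_sym Xt0 andbT.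
by apply: contra kP; rewrite /face_supp -(asm_jjj jJ) inE bil_ebase.
Qed.

(** Both alternatives are open in [(t, X)]. At a zero [t] of [X0] the vector in the second one is
    [2 X0 t], positive off the support. Compactness of the simplex makes [e] uniform. *)
Lemma copositive_near : \forall e \near at_right (0 : R), forall t, simplex t ->
  forall X, l1norm (X - X0) <= e -> 0 < bil X t t \/
  exists s, forall k, k \notin face_supp s ->
    0 < (X *m (t + sel (face_supp s) *m ((sel (face_supp s))^T *m t))) k 0.
Proof.
pose D := [set x : 'rV[R]_p | simplex x^T]%classic.
pose good e (x : 'rV[R]_p) := D x -> forall X, l1norm (X - X0) <= e ->
  0 < bil X x^T x^T \/ exists s, forall k, k \notin face_supp s ->
    0 < (X *m (x^T + sel (face_supp s) *m ((sel (face_supp s))^T *m x^T))) k 0.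
have l1D x : D x -> l1norm x = 1.
  move=> [_ <-]; rewrite /l1norm big_ord1; apply: eq_bigr => k _; by rewrite mxE.
have Dcomp : compact D.
  apply: compact_box_closed; last by move=> x /l1D <- i; exact: le_l1norm.
  have -> : D = ([set x | l1norm x = 1] `&`
                 \bigcap_(k in [set: 'I_p]) [set x : 'rV[R]_p | 0 <= x 0 k])%classic.
    apply/seteqP; split=> x.
      move=> Dx; split; first exact: l1D.
      by have [x0 _] := Dx; move=> k _ /=; have := x0 k; rewrite mxE.
    move=> [/= x1 x0]; split; first by move=> k; rewrite mxE; exact: (x0 k).
    by rewrite -x1 /l1norm big_ord1; apply: eq_bigr => k _; rewrite mxE.
  apply: closedI; first exact/closed_level/l1norm_continuous.
  apply: closed_bigI => k _.
  apply: (preimage_closed (D := [set z : R | 0 <= z]%classic)); last exact: closed_ge.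
  by move=> x _; exact: coord_continuous.
have : \forall e \near at_right (0 : R), (D `<=` good e)%classic.
  apply: (iffLR (compact_near_coveringP D) Dcomp) => x Dx.
  have [xx|xx] := ltP 0 (bil X0 x^T x^T).
    pose c := bil X0 x^T x^T / 2; have c0 : 0 < c by rewrite divr_gt0.
    have cx : c < bil X0 x^T x^T by rewrite /c; lra.
    have near_x : \forall y \near x, c < bil X0 y^T y^T.
      by apply: (near_gt (f := fun y => bil X0 y^T y^T)) => //; exact: bil_continuous.
    have near_e : \forall e \near at_right (0 : R), e < c by exact: nbhs_right_lt.
    exists ([set y | c < bil X0 y^T y^T], [set e | e < c])%classic => //=.
    move=> [y e] [/= cy ec] Dy X Xe; left.
    have := norm_bil (X - X0) y^T; rewrite bilDm bilNm distrC => h1.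
    have h2 : l1norm (X - X0) * bil 1%:M y^T y^T <= e * 1.
      apply: ler_pM; rewrite ?l1norm_ge0 ?bil1_ge0 //.
      by apply: le_trans (bil1_le_l1norm _) _; rewrite l1norm_tr l1D // expr1n.
    have := ler_norm (bil X0 y^T y^T - bil X y^T y^T); lra.
  have {}xx : bil X0 x^T x^T = 0.
    by apply/eqP; rewrite eq_le xx; apply: X0cop; have [] := Dx.
  have [s [xP Xx]] := simplex_near_face Dx xx.
  pose Pm : 'M[R]_p := 1%:M + sel (face_supp s) *m (sel (face_supp s))^T.
  pose c1 := l1norm Pm + 1.
  have PmE (y : 'cV[R]_p) : y + sel (face_supp s) *m ((sel (face_supp s))^T *m y) = Pm *m y.
    by rewrite mulmxDl mul1mx mulmxA.
  pose ok k (z : 'rV[R]_p * R) := k \notin face_supp s -> D z.1 ->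
    forall X : 'M[R]_p, l1norm (X - X0) <= z.2 -> 0 < (X *m (Pm *m z.1^T)) k 0.
  have near_xe k : filter_prod (nbhs x) (at_right (0 : R)) (ok k).
    have [kP|kP] := boolP (k \in face_supp s).
      exists (setT, setT); first by split; exact: filterT.
      by move=> z _; rewrite /ok kP.
    pose c := (X0 *m x^T) k 0; have c0 : 0 < c := Xx k kP.
    have fx : (X0 *m (Pm *m x^T)) k 0 = c + c.
      by rewrite -PmE xP mulmxDr mxE.
    have fc : continuous (fun y : 'rV[R]_p => (X0 *m (Pm *m y^T)) k 0).
      have -> : (fun y : 'rV[R]_p => (X0 *m (Pm *m y^T)) k 0) =
                (fun y : 'rV[R]_p => \sum_l (X0 *m Pm) k l * y 0 l).
        by apply/funext => y; rewrite mulmxA mxE; apply: eq_bigr => l _; rewrite [y^T l 0]mxE.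
      apply: sum_continuous => l; apply: mul_continuous; last exact: coord_continuous.
      exact: cst_continuous.
    have near_x : \forall y \near x, c < (X0 *m (Pm *m y^T)) k 0.
      by apply: (near_gt fc); rewrite fx ltrDl.
    have near_e : \forall e \near at_right (0 : R), c1 * e <= c by exact: near_mul_le.
    exists ([set y | c < (X0 *m (Pm *m y^T)) k 0], [set e | c1 * e <= c])%classic => //=.
    move=> [y e] [/= cy ec] _ Dy X Xe.
    have e0 : 0 <= e by apply: le_trans Xe; exact: l1norm_ge0.
    have h : `|((X - X0) *m (Pm *m y^T)) k 0| <= c.
      apply: le_trans (le_l1norm _ _ _) _; apply: le_trans (l1normM _ _) _.
      apply: le_trans ec; rewrite mulrC; apply: ler_pM; rewrite ?l1norm_ge0 //.
      apply: le_trans (l1normM _ _) _; rewrite l1norm_tr l1D // mulr1 /c1 lerDl.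
      exact: ler01.
    have XE : (X *m (Pm *m y^T)) k 0 = (X0 *m (Pm *m y^T)) k 0 + ((X - X0) *m (Pm *m y^T)) k 0.
      by rewrite -[X in X *m _](subrK X0) addrC mulmxDl mxE.
    rewrite XE; move: h; rewrite ler_norml => /andP[h _]; lra.
  apply: (filterS _ (filter_forall _ near_xe)) => -[y e] /= H Dy X Xe; right; exists s => k kP.
  by rewrite PmE; exact: H.
apply: filterS => e He t ts X Xe.
have Dt : D t^T by rewrite /D /= trmxK.
by have := He _ Dt Dt X Xe; rewrite trmxK.
Qed.

End FaceDecomposition.

(** * The local description of the complementarity set *)

Section NormOnSymmetricPairs.
Context {R : realType} {p : nat}.

(** [N] is controlled only on symmetric pairs. Evaluated at the symmetrised pair, with the
    antisymmetric parts added in [l1norm], it becomes a norm on all pairs. *)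
Lemma norm_on_dominates (N : 'M[R]_p * 'M[R]_p -> R) : norm_on symmetric_pairs N ->
  exists2 C, 0 < C & forall X U, X^T = X -> U^T = U ->
    l1norm X + l1norm U <= C * N (X, U).
Proof.
move=> [N_ge0 N_eq0 NZ ND]; pose sym (X : 'M[R]_p) := X + X^T.
have symZ a X : sym (a *: X) = a *: sym X by rewrite /sym linearZ scalerDr.
have symD X Y : sym (X + Y) = sym X + sym Y by rewrite /sym linearD addrACA.
have symP (Z : 'M[R]_p * 'M[R]_p) : symmetric_pairs (sym Z.1, sym Z.2).
  by split; apply/symmetricmxP; rewrite /sym linearD /= trmxK addrC.
pose f (Z : 'M[R]_p * 'M[R]_p) :=
  N (sym Z.1, sym Z.2) + l1norm (Z.1 - Z.1^T) + l1norm (Z.2 - Z.2^T).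
pose g (Z : 'M[R]_p * 'M[R]_p) := l1norm Z.1 + l1norm Z.2.
have fs : seminorm f.
  apply: seminormD; first apply: seminormD.
  - split=> [a Z|Z Z'] /=.
      by rewrite !symZ -[X in N X]/(a *: (sym Z.1, sym Z.2)) NZ.
    rewrite !symD -[X in N X <= _]/((sym Z.1, sym Z.2) + (sym Z'.1, sym Z'.2)).
    exact: ND.
  - apply: seminorm_l1norm => [a Z|Z Z'] /=; first by rewrite linearZ scalerBr.
    by rewrite linearD opprD addrACA.
  - apply: seminorm_l1norm => [a Z|Z Z'] /=; first by rewrite linearZ scalerBr.
    by rewrite linearD opprD addrACA.
have gs : seminorm g by apply: seminormD; apply: seminorm_l1norm.
have f0 Z : f Z = 0 -> Z = 0.
  move=> /eqP; rewrite !paddr_eq0 ?addr_ge0 ?l1norm_ge0 ?N_ge0 //.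
  move=> /andP[/andP[/eqP/(N_eq0 _ (symP Z)) NZ0 /eqP/l1norm_eq0 Z1] /eqP/l1norm_eq0 Z2].
  case: Z NZ0 Z1 Z2 => X U /= [X0 U0] /eqP + /eqP; rewrite !subr_eq0.
  have half (Y : 'M[R]_p) : sym Y = 0 -> Y == Y^T -> Y = 0.
    rewrite /sym => + /eqP YT; rewrite -YT => Y0; apply/matrixP => i j.
    have /matrixP/(_ i j) := Y0; rewrite !mxE; lra.
  by move=> XT UT; congr (_, _); apply: half.
have [C C0 gf] := norm_dominates fs gs f0.
exists (C * 2) => [|X U Xs Us]; first by rewrite mulr_gt0.
have := gf (X, U); rewrite /g /f /= Xs Us !subrr !l1norm0 !addr0.
have XU : symmetric_pairs (X, U) by split; apply/symmetricmxP.
have -> : (sym X, sym U) = 2 *: (X, U).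
  by rewrite /sym Xs Us; congr (_, _); rewrite -mulr2n scaler_nat.
by rewrite NZ // ger0_norm // mulrA.
Qed.

End NormOnSymmetricPairs.

Section CompletelyPositiveSums.
Context {R : realType} {p : nat}.

Lemma cpD (A B : 'M[R]_p) : CP A -> CP B -> CP (A + B).
Proof.
move=> /cpP[k [C [C0 ->]]] /cpP[l [D [D0 ->]]]; apply/cpP.
exists (k + l)%N, (row_mx C D); split; last by rewrite tr_row_mx mul_row_col.
move=> i j; rewrite mxE; case: (fintype.split j) => j'; [exact: C0|exact: D0].
Qed.

Lemma cp_sum (I : Type) (r : seq I) (A : I -> 'M[R]_p) :
  (forall i, CP (A i)) -> CP (\sum_(i <- r) A i).
Proof.
move=> Acp; elim/big_rec: _ => [|i B _]; last exact: cpD.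
by apply/cpP; exists 0%N, 0; split=> [i j|]; rewrite ?mxE ?mul0mx.
Qed.

End CompletelyPositiveSums.

Theorem theorem4p3 (R : realType) (p : nat) (p_gt0 : (0 < p)%N)
    (N : 'M[R]_p * 'M[R]_p -> R) (N_norm : norm_on symmetric_pairs N)
    (X0 U0 : 'M[R]_p) (X0U0 : complementarity_set (X0, U0))
    (Ta_neq0 : (zeros X0 !=set0)%classic)
    (m : nat) (tau : 'I_m -> 'cV[R]_p) (tauP : enumerates_vertices X0 tau)
    (q : nat) (Js : 'I_q -> {set 'I_m}) (JsP : maximal_division X0 tau Js)
    (Jb : 'I_q -> {set 'I_m}) (JbP : forall s, basis_subset tau (Jb s) (Js s))
    (asm_j : relative_interior (CP `&` orthogonal_space X0)%classic U0)
    (asm_jj : free (sum_squares tau Jb))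
    (asm_jjj : forall s j, j \in Js s -> M_set X0 tau j = P_star tau (Js s)) :
  exists2 eps0 : R, 0 < eps0 &
    forall X U : 'M[R]_p, X \is symmetricmx -> U \is symmetricmx ->
      N ((X, U) - (X0, U0)) <= eps0 ->
      (complementarity_set (X, U) <->
       exists W : forall s : 'I_q, 'M[R]_#|P_star tau (Js s)|,
         [/\ forall s, W s \is symmetricmx,
             forall s, principal_submx (P_star tau (Js s)) X *m W s +
                       W s *m principal_submx (P_star tau (Js s)) X = 0 &
             U = \sum_s embed_mx (W s)]).
Proof.
have [[/= /symmetricmxP X0s X0cop] _ _] := X0U0.
have [k [B [r [r0 B0 U0E ri]]]] :=
  face_center X0s X0cop tauP JsP JbP asm_jj asm_jjj asm_j.
pose V := face_gens tau Js; pose E := face_sel tau Js; pose A0 := face_form X0 tau Js.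
pose Q := face_proj tau Js; pose Sc := face_coord tau Js.
pose W0 s := V s *m B s *m (V s *m B s)^T.
have W0s s : (W0 s)^T = W0 s by rewrite /W0 trmx_mul trmxK.
have QV s : Q s *m V s = V s := face_proj_gens tau Js s.
have AV s : A0 s *m V s = 0 := face_form_gens asm_jjj s.
have AW0 s : A0 s *m W0 s = 0
  by rewrite /W0; move: (V s) (AV s) => Vs AVs; rewrite !mulmxA AVs !mul0mx.
have W0Q s : Q s *m W0 s *m (Q s)^T = W0 s.
  rewrite /W0; move: (V s) (Q s) (QV s) => Vs Qs QVs.
  by rewrite -{3}QVs -{4}QVs !trmx_mul !mulmxA.
have A0s s : (A0 s)^T = A0 s := face_form_sym X0s tau Js s.
have A0p s : psd (A0 s) by exact: (face_form_psd X0s X0cop tauP asm_jjj).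
have A0ker s : forall x : 'cV_#|face_supp tau Js s|, A0 s *m x = 0 -> Q s *m x = x.
  by move=> x; exact: (face_form_ker X0s X0cop tauP JsP asm_jjj).
have V0 s : nonnegmx (V s) by exact: (face_gens_ge0 tauP).
have Vpos s : forall i, exists j, 0 < V s i j .
  exact: (face_gens_gt0 tauP).
pose A s (X : 'M[R]_p) := principal_submx (face_supp tau Js s) X.
have [d d0 [dlyap dorth]] : exists2 d, 0 < d & (forall s X W, X^T = X -> W^T = W ->
    l1norm (X - A0 s) <= d -> l1norm (W - W0 s) <= d -> X *m W + W *m X = 0 ->
    psd X /\ exists l (C : 'M[R]_(_, l)), nonnegmx C /\ W = C *m C^T) /\
  (forall s X l (C : 'M[R]_(_, l)), X^T = X -> (forall x, nonneg x -> 0 <= bil X x x) ->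
    nonnegmx C -> l1norm (X - A0 s) <= d -> l1norm (C *m C^T - W0 s) <= d ->
    \tr (X *m (C *m C^T)) = 0 -> X *m C = 0).
  near (at_right (0 : R)) => d; exists d => //; split; near: d; apply: filter_forall => s.
    exact: (face_of_lyapunov (S := Sc s) erefl (QV s) (V0 s) (Vpos s) (A0s s) (A0p s) (AV s)
              (A0ker s) (W0s s) (W0Q s) r0 (ri s)).
  exact: (face_of_orthogonal (S := Sc s) erefl (QV s) (V0 s) (Vpos s) (A0s s) (A0p s) (AV s)
            (A0ker s) (W0Q s) r0 (ri s)).
have [L L0 AL] := face_form_near X0 tau Js.
have [C C0 NC] := norm_on_dominates N_norm.
have [e e0 [Le lclose oclose copn]] : exists2 e, 0 < e & [/\ L * e <= d,
    forall X U (w : forall s, 'M[R]_#|face_supp tau Js s|),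
      l1norm (X - X0) <= e -> l1norm (U - U0) <= e -> (forall s, (w s)^T = w s) ->
      (forall s, A s X *m w s + w s *m A s X = 0) ->
      U = \sum_s E s *m w s *m (E s)^T -> forall s, l1norm (w s - W0 s) <= d,
    forall X U l (D : forall s, 'M[R]_(#|face_supp tau Js s|, l)),
      l1norm (X - X0) <= e -> l1norm (U - U0) <= e -> (forall s, nonnegmx (D s)) ->
      (forall s, \tr (A s X *m (D s *m (D s)^T)) = 0) ->
      U = \sum_s E s *m (D s *m (D s)^T) *m (E s)^T ->
      forall s, l1norm (D s *m (D s)^T - W0 s) <= d &
    forall t, simplex t -> forall X, l1norm (X - X0) <= e -> 0 < bil X t t \/
      exists s, forall k, k \notin face_supp tau Js s -> 0 <
        (X *m (t + sel (face_supp tau Js s) *m ((sel (face_supp tau Js s))^T *m t))) k 0].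
  near (at_right (0 : R)) => e; exists e => //; split.
  - by near: e; exact: near_mul_le.
  - near: e; exact: (lyapunov_close X0s X0cop tauP JsP JbP asm_jj asm_jjj W0s AW0 U0E d0).
  - near: e; exact: (orthogonal_close X0s X0cop tauP JsP JbP asm_jj asm_jjj W0s AW0 U0E d0).
  - near: e; exact: (copositive_near X0s X0cop tauP JsP asm_jjj).
have U0s : U0^T = U0 by have [[_ [/symmetricmxP]]] := asm_j.
exists (e / C) => [|X U /symmetricmxP Xs /symmetricmxP Us]; first by rewrite divr_gt0.
rewrite ler_pdivlMr // mulrC => NXU.
have XU : l1norm (X - X0) + l1norm (U - U0) <= e.
  by apply: le_trans (NC _ _ _ _) NXU; rewrite linearB /= ?Xs ?X0s ?Us ?U0s.
have Xe : l1norm (X - X0) <= e by have := l1norm_ge0 (U - U0); lra.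
have Ue : l1norm (U - U0) <= e by have := l1norm_ge0 (X - X0); lra.
have AX s : l1norm (A s X - A0 s) <= d.
  by apply: le_trans (AL s X) _; apply: le_trans Le; rewrite ler_pM2l.
have As s : (A s X)^T = A s X by rewrite /A principal_submxE !trmx_mul trmxK Xs mulmxA.
split=> [[/= Xc /cpP[l [D [D0 UE]]] trXU]|[W [Ws LW UE]]].
  have [_ Xcop] : COP X := Xc.
  have Dcol j : nonneg (col j D) by move=> i; rewrite mxE.
  have Dz j : bil X (col j D) (col j D) = 0.
    move: trXU; rewrite /inner /= UE mxtrace_gram => /eqP.
    rewrite psumr_eq0 => [/allP H|i _]; last exact: Xcop.
    exact/eqP/(H j (mem_index_enum _)).
  (* Each column of [D] is a zero of [X], which excludes the first alternative of [copn]; the second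
     confines its support. A zero column may go to any face, and [0 < q] supplies one. *)
  have /choice[f fP] j : exists s, forall i, i \notin face_supp tau Js s -> D i j = 0.
    have [Dj|Dj] := eqVneq (col j D) 0.
      have [q_gt0 _ _] := JsP; exists (Ordinal q_gt0) => i _.
      by have /colP/(_ i) := Dj; rewrite !mxE.
    have [a a0 aD] := simplex_scale (Dcol j) Dj.
    have Dz' : bil X (a *: col j D) (a *: col j D) = 0 by rewrite bilZl bilZr Dz !mulr0.
    have [aD0 _] := aD.
    have [|[s sP]] := copn _ aD X Xe; first by rewrite Dz' ltxx.
    exists s => i iP; have := copositive_zero_supp Xs Xcop aD0 Dz' sP iP.
    by rewrite !mxE => /eqP; rewrite mulf_eq0 gt_eqF //= => /eqP.
  pose Dm s := \matrix_(i, j) (if f j == s then D i j else 0) : 'M[R]_(p, l).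
  have colDm s j : col j (Dm s) = if f j == s then col j D else 0.
    by apply/colP => i; rewrite !mxE; case: ifP => // _; rewrite !mxE.
  pose F s := (E s)^T *m Dm s.
  have EF s : E s *m F s = Dm s.
    apply: sel_supported => i j iP; rewrite mxE; case: eqP => // fj.
    by apply: fP; rewrite fj.
  have F0 s : nonnegmx (F s) by move=> i j; rewrite tr_sel_mul mxE; case: ifP.
  have UF : U = \sum_s E s *m (F s *m (F s)^T) *m (E s)^T.
    transitivity (\sum_s \sum_j col j (Dm s) *m (col j (Dm s))^T); last first.
      by apply: eq_bigr => s _; rewrite -gramE -EF trmx_mul !mulmxA.
    rewrite UE gramE exchange_big; apply: eq_bigr => j _.
    rewrite (bigD1 (f j)) //= colDm eqxx big1 ?addr0 // => s /negPf sf.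
    by rewrite colDm eq_sym sf mul0mx.
  have trAF s : \tr (A s X *m (F s *m (F s)^T)) = 0.
    rewrite mxtrace_gram big1 // => j _; rewrite -bil_sel -[sel _]/(E s).
    have -> : E s *m col j (F s) = col j (Dm s) by rewrite !colE mulmxA EF.
    by rewrite colDm; case: ifP => // _; rewrite bil0l.
  have AF s : A s X *m F s = 0.
    apply: (dorth s) => //; last by apply: (oclose X U _ F).
    by move=> x x0; rewrite -bil_sel; apply/Xcop/sel_ge0_cV.
  exists (fun s => F s *m (F s)^T); split.
  - by move=> s; apply/symmetricmxP; rewrite trmx_mul trmxK.
  - move=> s; rewrite -[principal_submx _ _]/(A s X) mulmxA AF mul0mx add0r -mulmxA.
    by rewrite -{1}[A s X]As -trmx_mul AF trmx0 mulmx0.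
  - by rewrite UF; apply: eq_bigr => s _; rewrite embed_mxE.
have {}Ws s : (W s)^T = W s by apply/symmetricmxP.
have UW : U = \sum_s E s *m W s *m (E s)^T.
  by rewrite UE; apply: eq_bigr => s _; rewrite embed_mxE.
have AW s : psd (A s X) /\ exists l (D : 'M[R]_(_, l)), nonnegmx D /\ W s = D *m D^T.
  exact: (dlyap s _ _ (As s) (Ws s) (AX s) (lclose X U W Xe Ue Ws LW UW s) (LW s)).
split.
- split; first exact/symmetricmxP.
  move=> t t0; have [->|tn0] := eqVneq t 0; first by rewrite bil0l.
  have [a a0 at_] := simplex_scale t0 tn0; have [at0 _] := at_.
  have : 0 <= bil X (a *: t) (a *: t).
    have [/ltW //|[s sP]] := copn _ at_ X Xe.
    by apply: psd_extend_supp sP => //; have [] := AW s.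
  by rewrite bilZl bilZr mulrA pmulr_rge0 // mulr_gt0.
- rewrite /= UW; apply: cp_sum => s; have [_ [l [D [D0 ->]]]] := AW s.
  apply/cpP; exists l, (E s *m D); split; first exact: sel_ge0.
  by rewrite trmx_mul !mulmxA.
- rewrite /inner /= UW mulmx_sumr linear_sum big1 // => s _ /=.
  (* The trace of the Lyapunov equation. *)
  have : \tr (A s X *m W s) *+ 2 = 0.
    by rewrite mulr2n [X in _ + X]mxtrace_mulC -mxtraceD LW mxtrace0.
  rewrite -mulr_natr => /eqP; rewrite mulf_eq0 pnatr_eq0 orbF => /eqP <-.
  by rewrite /A principal_submxE -!mulmxA [RHS]mxtrace_mulC -!mulmxA.
Unshelve. all: by end_near. Qed.
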